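(* Let $S$ be the minimal Laplacian on $L_2(0,1)$: $\mathcal{D}(S)=\{f\in H^2(0,1): f(0)=f(1)=f'(0)=f'(1)=0\}$, $Sf=-f''$. An extension of $S$ is a maximally dissipative extension of $S$ if and only if it is of the form $$S_{\mathcal W}:\qquad\mathcal{D}(S_{\mathcal W})=\mathcal{D}(S)\dot+\mathcal{W},\qquad S_{\mathcal W}f=S^*f=-f'',$$ where $\mathcal{W}$ is a subspace of $\mathcal{D}(S^* )=H^2(0,1)$ with $\mathcal{W}\cap\mathcal{D}(S)=\{0\}$, $\dim\mathcal{W}=2$ and $$\operatorname{Im}\left(\begin{pmatrix} u(0) & v(0) \\ u(1) & v(1) \end{pmatrix}^*\begin{pmatrix} u'(0) & v'(0) \\ -u'(1) & -v'(1) \end{pmatrix}\right)\ge0\qquad( * )$$ for one, and hence for every, basis $\{u,v\}$ of $\mathcal{W}$. The extension is selfadjoint if and only if equality holds in $( * )$ for one, and hence for every, basis of $\mathcal{W}$.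
   Context: $L_2(0,1)$ is complex with inner product linear in the second argument. The adjoint of $S$ is $S^*f=-f''$ with $\mathcal{D}(S^* )=H^2(0,1)$. A densely defined operator $T$ is dissipative if $\operatorname{Im}\langle x,Tx\rangle\ge0$ for all $x\in\mathcal{D}(T)$, and maximally dissipative if it is dissipative and has no non-trivial dissipative extension. For a square matrix $M$, $\operatorname{Im}M:=\frac1{2\mathrm{i}}(M-M^* )$. *)

(* Defs.v *)
From HB Require Import structures.
From mathcomp Require Import all_boot all_order all_algebra.
From mathcomp Require Import complex ring lra.
From mathcomp Require Import all_classical all_reals all_analysis.
From mathcomp Require Import measurable_realfun.

Set Implicit Arguments.
Unset Strict Implicit.
Unset Printing Implicit Defensive.

Import Order.TTheory GRing.Theory Num.Theory.
Import numFieldNormedType.Exports.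

Local Open Scope classical_set_scope.
Local Open Scope ring_scope.
Local Open Scope complex_scope.
Local Open Scope sesquilinear_scope.
Local Open Scope quotient_scope.

Definition I01 (R : realType) : set R := `]0, 1[%classic.
Arguments I01 R : clear implicits.

Definition sq_int (R : realType) (f : R -> R[i]) : Prop :=
  [/\ measurable_fun (I01 R) (fun x => complex.Re (f x)),
      measurable_fun (I01 R) (fun x => complex.Im (f x)) &
      (@lebesgue_measure R).-integrable (I01 R)
        (fun x => (complex.Re (f x) ^+ 2 + complex.Im (f x) ^+ 2)%:E)].

Definition ae01 (R : realType) (f g : R -> R[i]) : Prop :=
  f = g %[ae @lebesgue_measure R in I01 R].

Record sqfun (R : realType) :=
  SqFun { sqfun_val :> R -> R[i]; sqfunP : sq_int sqfun_val }.

HB.instance Definition _ (R : realType) := gen_eqMixin (sqfun R).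
HB.instance Definition _ (R : realType) := gen_choiceMixin (sqfun R).

Section L2_space.
Variable R : realType.
Implicit Types f g h : R -> R[i].

Lemma ae01_filter : Filter (almost_everywhere (@lebesgue_measure R)).
Proof. exact: (ae_filter_ringOfSetsType (@lebesgue_measure R)). Qed.

Lemma ae01W f g : (forall x, f x = g x) -> ae01 f g.
Proof. by move=> fg; apply: (@filterE _ _ ae01_filter) => x _; rewrite fg. Qed.

Lemma ae01_refl f : ae01 f f.
Proof. exact: ae01W. Qed.

Lemma ae01_sym f g : ae01 f g -> ae01 g f.
Proof. by apply: (@filterS _ _ ae01_filter) => x fg /fg. Qed.

Lemma ae01_trans g f h : ae01 f g -> ae01 g h -> ae01 f h.
Proof.
by apply: (@filterS2 _ _ ae01_filter) => x fg gh Ix; rewrite fg// gh.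
Qed.

Lemma ae01D f f' g g' : ae01 f f' -> ae01 g g' ->
  ae01 (fun x => f x + g x) (fun x => f' x + g' x).
Proof.
by apply: (@filterS2 _ _ ae01_filter) => x ff gg Ix; rewrite ff// gg.
Qed.

Lemma ae01Z (a : R[i]) f f' : ae01 f f' ->
  ae01 (fun x => a * f x) (fun x => a * f' x).
Proof. by apply: (@filterS _ _ ae01_filter) => x ff Ix; rewrite ff. Qed.

Lemma measurable_I01 : measurable (I01 R).
Proof. exact: measurable_itv. Qed.

(* Lebesgue measure lives on [measurableTypeR R], whose display differs from
   the one of R. *)
Lemma measurable_I01R : measurable (I01 R : set (measurableTypeR R)).
Proof. exact: measurable_itv. Qed.

Lemma sq_int_cst0 : sq_int (fun _ : R => 0 : R[i]).
Proof.
split; [exact: measurable_cst|exact: measurable_cst|].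
rewrite /= expr0n/= addr0.
exact: integrable0.
Qed.

Lemma sq_intN f : sq_int f -> sq_int (fun x => - f x).
Proof.
move=> [mr mi ii]; split.
- rewrite (_ : (fun x => _) = (fun x => - complex.Re (f x))).
    exact: measurableT_comp.
  by apply/funext => x; case: (f x).
- rewrite (_ : (fun x => _) = (fun x => - complex.Im (f x))).
    exact: measurableT_comp.
  by apply/funext => x; case: (f x).
- apply: eq_integrable ii; first exact: measurable_I01R.
  by move=> x _; case: (f x) => a b /=; rewrite !sqrrN.
Qed.

Lemma sq_intD f g : sq_int f -> sq_int g -> sq_int (fun x => f x + g x).
Proof.
move=> [fr fi fint] [gr gi gint].
have er : (fun x => complex.Re (f x + g x)) =
    (fun x => complex.Re (f x) + complex.Re (g x)).
  by apply/funext => x; case: (f x) => a b; case: (g x).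
have ei : (fun x => complex.Im (f x + g x)) =
    (fun x => complex.Im (f x) + complex.Im (g x)).
  by apply/funext => x; case: (f x) => a b; case: (g x).
have mr : measurable_fun (I01 R) (fun x => complex.Re (f x + g x)).
  by rewrite er; exact: measurable_funD.
have mi : measurable_fun (I01 R) (fun x => complex.Im (f x + g x)).
  by rewrite ei; exact: measurable_funD.
split=> //.
have := integrableD measurable_I01R (integrableZl measurable_I01R 2 fint)
  (integrableZl measurable_I01R 2 gint).
apply: le_integrable; first exact: measurable_I01R.
  apply/measurable_EFinP/measurable_funD; exact: measurable_funX.
move=> x _ /=; rewrite lee_fin.
case: (f x) => a b; case: (g x) => c d /=.
rewrite !ger0_norm; last 2 first.
- by rewrite addr_ge0 ?mulr_ge0 ?addr_ge0 ?sqr_ge0.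
- by rewrite addr_ge0 ?sqr_ge0.
by have := sqr_ge0 (a - c); have := sqr_ge0 (b - d); nra.
Qed.

Lemma sq_intZ (a : R[i]) f : sq_int f -> sq_int (fun x => a * f x).
Proof.
case: a => a b [fr fi fint].
have er : (fun x => complex.Re ((a +i* b) * f x)) =
    (fun x => a * complex.Re (f x) - b * complex.Im (f x)).
  by apply/funext => x; case: (f x).
have ei : (fun x => complex.Im ((a +i* b) * f x)) =
    (fun x => a * complex.Im (f x) + b * complex.Re (f x)).
  by apply/funext => x; case: (f x).
split.
- rewrite er; apply: measurable_funB; exact: measurable_funM.
- rewrite ei; apply: measurable_funD; exact: measurable_funM.
- apply: eq_integrable (integrableZl measurable_I01R (a ^+ 2 + b ^+ 2) fint).
    exact: measurable_I01R.
  move=> x _; case: (f x) => c d /=; rewrite -EFinM; congr (_%:E).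
  by ring.
Qed.

Definition sq_eqv (f g : sqfun R) : bool := `[< ae01 f g >].

Lemma sq_eqv_refl : reflexive sq_eqv.
Proof. by move=> f; apply/asboolP/ae01_refl. Qed.

Lemma sq_eqv_sym : symmetric sq_eqv.
Proof. by move=> f g; apply/asboolP/asboolP => /ae01_sym. Qed.

Lemma sq_eqv_trans : transitive sq_eqv.
Proof.
by move=> g f h /asboolP fg /asboolP gh; apply/asboolP/(ae01_trans fg gh).
Qed.

Canonical sq_eqv_canonical := EquivRel sq_eqv sq_eqv_refl sq_eqv_sym sq_eqv_trans.

Definition L2 : Type := {eq_quot sq_eqv}.
HB.instance Definition _ := Choice.on L2.
HB.instance Definition _ := EqQuotient.on L2.

Definition L2_fun (u : L2) : R -> R[i] := repr u : sqfun R.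
Coercion L2_fun : L2 >-> Funclass.

Definition toL2 f (hf : sq_int f) : L2 := \pi_L2 (SqFun hf).

Lemma L2_sq_int (u : L2) : sq_int u.
Proof. exact: sqfunP. Qed.

Lemma L2_eqP (u v : L2) : u = v <-> ae01 u v.
Proof.
split=> [->|uv]; first exact: ae01_refl.
rewrite -[u]reprK -[v]reprK.
by apply/eqP; rewrite eqmodE; apply/asboolP.
Qed.

Lemma toL2K f (hf : sq_int f) : ae01 (toL2 hf) f.
Proof.
have /eqP : \pi_L2 (repr (toL2 hf)) = \pi_L2 (SqFun hf) by rewrite reprK.
by rewrite eqmodE => /asboolP.
Qed.

Definition L2_zero : L2 := toL2 sq_int_cst0.
Definition L2_opp (u : L2) : L2 := toL2 (sq_intN (L2_sq_int u)).
Definition L2_add (u v : L2) : L2 := toL2 (sq_intD (L2_sq_int u) (L2_sq_int v)).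
Definition L2_scale (a : R[i]) (u : L2) : L2 := toL2 (sq_intZ a (L2_sq_int u)).

Lemma L2_addA : associative L2_add.
Proof.
move=> u v w; apply/L2_eqP.
apply: ae01_trans (toL2K _) _; apply: ae01_sym; apply: ae01_trans (toL2K _) _.
apply: ae01_trans (ae01D (toL2K _) (ae01_refl _)) _.
apply: ae01_sym; apply: ae01_trans (ae01D (ae01_refl _) (toL2K _)) _.
by apply: ae01W => x; rewrite addrA.
Qed.

Lemma L2_addC : commutative L2_add.
Proof.
move=> u v; apply/L2_eqP.
apply: ae01_trans (toL2K _) _; apply: ae01_sym; apply: ae01_trans (toL2K _) _.
by apply: ae01W => x; rewrite addrC.
Qed.

Lemma L2_add0 : left_id L2_zero L2_add.
Proof.
move=> u; apply/L2_eqP; apply: ae01_trans (toL2K _) _.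
apply: ae01_trans (ae01D (toL2K _) (ae01_refl _)) _.
by apply: ae01W => x; rewrite add0r.
Qed.

Lemma L2_addN : left_inverse L2_zero L2_opp L2_add.
Proof.
move=> u; apply/L2_eqP; apply: ae01_trans (toL2K _) _.
apply: ae01_trans (ae01D (toL2K _) (ae01_refl _)) _.
apply: ae01_sym; apply: ae01_trans (toL2K _) _.
by apply: ae01W => x; rewrite addNr.
Qed.

HB.instance Definition _ :=
  GRing.isZmodule.Build L2 L2_addA L2_addC L2_add0 L2_addN.

Lemma L2_scaleA (a b : R[i]) (u : L2) :
  L2_scale a (L2_scale b u) = L2_scale (a * b) u.
Proof.
apply/L2_eqP; apply: ae01_trans (toL2K _) _.
apply: ae01_trans (ae01Z _ (toL2K _)) _; apply: ae01_sym.
apply: ae01_trans (toL2K _) _.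
by apply: ae01W => x; rewrite mulrA.
Qed.

Lemma L2_scale1 : left_id 1 L2_scale.
Proof.
move=> u; apply/L2_eqP; apply: ae01_trans (toL2K _) _.
by apply: ae01W => x; rewrite mul1r.
Qed.

Lemma L2_scaleDr : right_distributive L2_scale +%R.
Proof.
move=> a u v; apply/L2_eqP; apply: ae01_trans (toL2K _) _.
apply: ae01_trans (ae01Z _ (toL2K _)) _; apply: ae01_sym.
apply: ae01_trans (toL2K _) _.
apply: ae01_trans (ae01D (toL2K _) (toL2K _)) _.
by apply: ae01W => x; rewrite mulrDr.
Qed.

Lemma L2_scaleDl (u : L2) : {morph L2_scale^~ u : a b / a + b}.
Proof.
move=> a b; apply/L2_eqP; apply: ae01_trans (toL2K _) _.
apply: ae01_sym; apply: ae01_trans (toL2K _) _.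
apply: ae01_trans (ae01D (toL2K _) (toL2K _)) _.
by apply: ae01W => x; rewrite mulrDl.
Qed.

HB.instance Definition _ := GRing.Zmodule_isLmodule.Build R[i] L2
  L2_scaleA L2_scale1 L2_scaleDr L2_scaleDl.

End L2_space.

Definition cint01 (R : realType) (f : R -> R[i]) : R[i] :=
  (\int[@lebesgue_measure R]_(x in I01 R) complex.Re (f x)) +i*
  (\int[@lebesgue_measure R]_(x in I01 R) complex.Im (f x)).

(* Linear in the second argument. *)
Definition inner (R : realType) (f g : L2 R) : R[i] :=
  cint01 (fun x => (f x)^* * g x).

Definition L2norm (R : realType) (f : L2 R) : R :=
  Num.sqrt (complex.Re (inner f f)).

(* An operator, possibly not everywhere defined, is given by its graph: T' is
   an extension of T when T `<=` T', and T x is the unique y with T (x, y). *)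

Definition linear_operator (R : realType) (T : set (L2 R * L2 R)) : Prop :=
  submod_closed (mem T) /\ forall y : L2 R, T (0, y) -> y = 0.

Definition dom (R : realType) (T : set (L2 R * L2 R)) : set (L2 R) :=
  [set x | exists y, T (x, y)].

Definition densely_defined (R : realType) (T : set (L2 R * L2 R)) : Prop :=
  forall (f : L2 R) (e : R), 0 < e -> exists2 x, dom T x & L2norm (f - x) < e.

Definition dissipative (R : realType) (T : set (L2 R * L2 R)) : Prop :=
  [/\ linear_operator T, densely_defined T &
      forall x y, T (x, y) -> 0 <= complex.Im (inner x y)].

Definition maximally_dissipative (R : realType) (T : set (L2 R * L2 R)) : Prop :=
  dissipative T /\ forall T', dissipative T' -> T `<=` T' -> T' = T.

Definition adjoint (R : realType) (T : set (L2 R * L2 R)) : set (L2 R * L2 R) :=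
  [set p | forall x y, T (x, y) -> inner p.1 y = inner p.2 x].

Definition selfadjoint (R : realType) (T : set (L2 R * L2 R)) : Prop :=
  [/\ linear_operator T, densely_defined T & adjoint T = T].

(* C^1 functions with compact support in (0,1), the usual test functions for
   Sobolev spaces on an interval; real-valued ones suffice, the defining
   identity of the weak derivative being linear in phi. *)
Definition test_fun (R : realType) (phi : R -> R) : Prop :=
  [/\ forall x, derivable phi x 1, continuous (derive1 phi) &
      exists a b : R, [/\ 0 < a, b < 1 &
        forall x, ~~ (a <= x <= b) -> phi x = 0]].

Definition weak_deriv (R : realType) (u g : L2 R) : Prop :=
  forall phi : R -> R, test_fun phi ->
    cint01 (fun x => u x * (derive1 phi x)%:C) = - cint01 (fun x => g x * (phi x)%:C).

Definition H1 (R : realType) : set (L2 R) := [set u | exists g, weak_deriv u g].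
Arguments H1 R : clear implicits.

(* The weak derivative, 0 (junk) outside H1. *)
Definition D (R : realType) (u : L2 R) : L2 R := xget 0 [set g | weak_deriv u g].

(* H^2(0,1): u and u' both have a weak derivative in L_2(0,1). *)
Definition H2 (R : realType) : set (L2 R) := [set u | H1 R u /\ H1 R (D u)].
Arguments H2 R : clear implicits.

Definition cont_rep (R : realType) (u : L2 R) (f : R -> R[i]) : Prop :=
  [/\ {within `[0, 1], continuous (fun x => complex.Re (f x))},
      {within `[0, 1], continuous (fun x => complex.Im (f x))} &
      ae01 u f].

(* Value at t in [0,1] of the continuous representative of u (junk if there is
   none): for u in H2, u(t) is [value u t] and u'(t) is [value (D u) t]. *)
Definition value (R : realType) (u : L2 R) (t : R) : R[i] :=
  xget (fun _ => 0) [set f | cont_rep u f] t.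

Definition Smin (R : realType) : set (L2 R * L2 R) :=
  [set p | [/\ H2 R p.1, value p.1 0 = 0 /\ value p.1 1 = 0,
     value (D p.1) 0 = 0 /\ value (D p.1) 1 = 0 & p.2 = - D (D p.1)]].
Arguments Smin R : clear implicits.

(* -d^2/dx^2 on all of H^2(0,1). *)
Definition Smax (R : realType) : set (L2 R * L2 R) :=
  [set p | H2 R p.1 /\ p.2 = - D (D p.1)].
Arguments Smax R : clear implicits.

(* D(S_W) = D(S) + W, and S_W is a restriction of the adjoint of S; the sum is
   direct by the condition on W in [admissible]. *)
Definition SW (R : realType) (W : set (L2 R)) : set (L2 R * L2 R) :=
  [set p | (exists f w, [/\ dom (Smin R) f, W w & p.1 = f + w]) /\
           adjoint (Smin R) p].

Definition basis2 (R : realType) (W : set (L2 R)) (u v : L2 R) : Prop :=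
  (forall a b : R[i], a *: u + b *: v = 0 -> a = 0 /\ b = 0) /\
  W = [set w | exists a b : R[i], w = a *: u + b *: v].

Definition admissible (R : realType) (W : set (L2 R)) : Prop :=
  [/\ submod_closed (mem W), W `<=` dom (adjoint (Smin R)),
      W `&` dom (Smin R) = [set 0] & exists u v, basis2 W u v].

Definition mx2 (K : Type) (a b c d : K) : 'M[K]_2 :=
  \matrix_(i, j) if i == 0 then (if j == 0 then a else b)
                 else (if j == 0 then c else d).

Definition ImM (R : realType) (n : nat) (M : 'M[R[i]]_n) : 'M[R[i]]_n :=
  (2%:R * 'i)^-1 *: (M - M ^t*).

(* M >= 0; over R[i] the relation 0 <= z says that z is real and nonnegative. *)
Definition psdmx (R : realType) (n : nat) (M : 'M[R[i]]_n) : Prop :=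
  forall x : 'cV[R[i]]_n, 0 <= (x ^t* *m M *m x) 0 0.

(* The matrix on the left-hand side of the inequality for the basis (u,v). *)
Definition boundary_mx (R : realType) (u v : L2 R) : 'M[R[i]]_2 :=
  ImM ((mx2 (value u 0) (value v 0)
            (value u 1) (value v 1)) ^t* *m
        mx2 (value (D u) 0) (value (D v) 0)
            (- value (D u) 1) (- value (D v) 1)).

(* Main.v *)
(* The primitives V g (x) = \int_0^x g describe everything: the weak derivative
   of u is g exactly when u = c + V g for a constant c, so H^2(0,1) consists of
   the c + V (d + V h), with explicit boundary values, and integration by parts
   is an identity between bounded sesquilinear forms that need only be checked on
   the indicators of the intervals (0,x). A dissipative extension T of S satisfies
   Im <x + c f, T x + c S f> >= 0 for all scalars c; as <f, S f> is real, this is an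
   affine function of c bounded below, whence T is contained in the adjoint of S.

   With p = x - i y and q = x + i y in C^2, for x = (u(0), u(1)) and
   y = (u'(0), - u'(1)), Green's formula reads
     4 Im <u, - u''> = |p|^2 - |q|^2,
   and p = q = 0 characterizes D(S). On the domain of a dissipative extension,
   p = 0 thus forces q = 0, so modulo D(S) the extension is given by a contraction
   from a subspace of C^2 to C^2. It is maximal if and only if this subspace is
   C^2, that is, the extension has dimension 2 over D(S); it is selfadjoint if and
   only if in addition the contraction is unitary. *)
Require Import Defs.
From HB Require Import structures.
From mathcomp Require Import all_boot all_order all_algebra.
From mathcomp Require Import complex ring lra.
From mathcomp Require Import all_classical all_reals all_analysis.
From mathcomp Require Import measurable_realfun.
From mathcomp Require finmap.

Import Order.TTheory GRing.Theory Num.Theory.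
Import numFieldNormedType.Exports.

Local Open Scope classical_set_scope.
Local Open Scope ring_scope.
Local Open Scope complex_scope.

Set Implicit Arguments.
Unset Strict Implicit.
Unset Printing Implicit Defensive.

(** Elements of [L2] have no point values. What replaces them is the inner product of g with the
    indicator of (0,x): it is the integral of g from 0 to x, depends only on the class of g, and by
    Cauchy-Schwarz is Hoelder continuous of order 1/2 in x, so continuous representatives come for
    free. Indicators suffice as test vectors because a closed subspace containing them is
    everything, by Dynkin's argument and simple functions. They are discontinuous, so trapezoids
    approximate them; this yields both that a class with weak derivative 0 is constant and that D(S)
    is dense. For the adjoint, D(S) contains V (V h) whenever h is orthogonal to 1 and to V 1, and
    the vectors orthogonal to all such h form the span of 1 and V 1, the solutions of u'' = 0.
    Maximality is linear algebra in C^2: if p maps W onto C^2, an element of a larger dissipative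
    operator differs from one of W by an element with p = 0; if the p-data of T fill only a proper
    subspace, a vector orthogonal to it gives room for an extension. *)

Section ComplexParts.
Variable R : realType.
Local Notation Re := (@complex.Re R).
Local Notation Im := (@complex.Im R).
Implicit Types a b z w : R[i].

Lemma complex_ext z w : Re z = Re w -> Im z = Im w -> z = w.
Proof. by case: z w => [a b] [c d] /= -> ->. Qed.

Lemma ReD z w : Re (z + w) = Re z + Re w.
Proof. by case: z w => [a b] [c d]. Qed.

Lemma ImD z w : Im (z + w) = Im z + Im w.
Proof. by case: z w => [a b] [c d]. Qed.

Lemma ReN z : Re (- z) = - Re z. Proof. by case: z. Qed.

Lemma ImN z : Im (- z) = - Im z. Proof. by case: z. Qed.

Lemma ReM z w : Re (z * w) = Re z * Re w - Im z * Im w.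
Proof. by case: z w => [a b] [c d]. Qed.

Lemma ImMul z w : Im (z * w) = Re z * Im w + Im z * Re w.
Proof. by case: z w => [a b] [c d]. Qed.

Lemma Re_conj z : Re (Num.conj z) = Re z. Proof. by case: z. Qed.

Lemma Im_conj z : Im (Num.conj z) = - Im z. Proof. by case: z. Qed.

Lemma Im_i : Im ('i : R[i]) = 1. Proof. by []. Qed.

Lemma Re_i : Re ('i : R[i]) = 0. Proof. by []. Qed.

Definition reimE := (ReD, ImD, ReN, ImN, ReM, ImMul, Re_conj, Im_conj, Im_i, Re_i).

Lemma conj_fixed z : z = Num.conj z -> z = (Re z)%:C.
Proof.
by case: z => a b [h]; congr (_ +i* _); lra.
Qed.

End ComplexParts.

(** * The inner product of L_2(0,1) and the Cauchy-Schwarz inequality *)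

Section Inner.
Variable R : realType.
Local Notation Re := (@complex.Re R).
Local Notation Im := (@complex.Im R).
Local Notation mu := (@lebesgue_measure R).
Local Notation I := (I01 R).
Implicit Types f g : R -> R[i].

Definition cintegrable f :=
  mu.-integrable I (EFin \o (fun x => Re (f x))) /\
  mu.-integrable I (EFin \o (fun x => Im (f x))).

Lemma eq_ae_cint01 f g : cintegrable f -> cintegrable g -> ae01 f g ->
  cint01 f = cint01 g.
Proof.
move=> [fr fi] [gr gi] fg; rewrite /cint01 /Rintegral.
congr (fine _ +i* fine _); apply: ae_eq_integral.
- exact: measurable_I01R.
- exact: measurable_int fr.
- exact: measurable_int gr.
- by apply: (@filterS _ _ (ae01_filter R) _ _ _ fg) => x h Ix; rewrite /= h.
- exact: measurable_I01R.
- exact: measurable_int fi.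
- exact: measurable_int gi.
- by apply: (@filterS _ _ (ae01_filter R) _ _ _ fg) => x h Ix; rewrite /= h.
Qed.

Lemma cintegrableD f g : cintegrable f -> cintegrable g ->
  cintegrable (fun x => f x + g x).
Proof.
move=> [fr fi] [gr gi]; split.
- have := integrableD (@measurable_I01R R) fr gr.
  apply: eq_integrable; first exact: measurable_I01R.
  by move=> x _ /=; rewrite ReD.
- have := integrableD (@measurable_I01R R) fi gi.
  apply: eq_integrable; first exact: measurable_I01R.
  by move=> x _ /=; rewrite ImD.
Qed.

Lemma cint01D f g : cintegrable f -> cintegrable g ->
  cint01 (fun x => f x + g x) = cint01 f + cint01 g.
Proof.
move=> [fr fi] [gr gi]; apply: complex_ext; rewrite ?ReD ?ImD /=.
- by under eq_Rintegral do rewrite ReD; rewrite RintegralD//; exact: measurable_I01R.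
- by under eq_Rintegral do rewrite ImD; rewrite RintegralD//; exact: measurable_I01R.
Qed.

Lemma cintegrableZ (a : R[i]) f : cintegrable f -> cintegrable (fun x => a * f x).
Proof.
move=> [fr fi]; have mI := @measurable_I01R R; split.
- have := integrableB mI (integrableZl mI (Re a) fr) (integrableZl mI (Im a) fi).
  apply: eq_integrable; first exact: mI.
  by move=> x _ /=; rewrite ReM -!EFinM -EFinB.
- have := integrableD mI (integrableZl mI (Re a) fi) (integrableZl mI (Im a) fr).
  apply: eq_integrable; first exact: mI.
  by move=> x _ /=; rewrite ImMul -!EFinM -EFinD.
Qed.

Lemma cint01Z (a : R[i]) f : cintegrable f ->
  cint01 (fun x => a * f x) = a * cint01 f.
Proof.
move=> [fr fi]; have mI := @measurable_I01R R.
have ir (k : R) : mu.-integrable I (EFin \o (fun x => k * Re (f x))).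
  by apply: eq_integrable (integrableZl mI k fr) => // x _ /=; rewrite EFinM.
have ii (k : R) : mu.-integrable I (EFin \o (fun x => k * Im (f x))).
  by apply: eq_integrable (integrableZl mI k fi) => // x _ /=; rewrite EFinM.
apply: complex_ext; rewrite ?ReM ?ImMul /=.
- by under eq_Rintegral do rewrite ReM; rewrite RintegralB// !RintegralZl.
- by under eq_Rintegral do rewrite ImMul; rewrite RintegralD// !RintegralZl.
Qed.

Lemma cint01_conj f : cintegrable f ->
  cint01 (fun x => (f x)^*%R) = ((cint01 f)^*)%R.
Proof.
move=> [fr fi]; apply: complex_ext; rewrite ?Re_conj ?Im_conj /=.
- by under eq_Rintegral do rewrite Re_conj.
- under eq_Rintegral do rewrite Im_conj -mulN1r.
  by rewrite RintegralZl ?mulN1r//; exact: measurable_I01R.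
Qed.

(** Both parts of the product are dominated by |f|^2 + |g|^2; the squares given to [nra] are those
    behind 2|ac| <= a^2 + c^2. *)
Lemma cintegrable_mul f g : sq_int f -> sq_int g ->
  cintegrable (fun x => (f x)^*%R * g x).
Proof.
move=> [fr fi fint] [gr gi gint].
have mI := @measurable_I01R R.
have hint := integrableD mI fint gint.
split; (apply: (le_integrable mI _ _ hint); [apply/measurable_EFinP|]).
- under eq_fun do rewrite ReM Re_conj Im_conj.
  apply: measurable_funB; apply: measurable_funM => //.
  exact: measurableT_comp.
- move=> x _; rewrite /= lee_fin ReM Re_conj Im_conj.
  move: (Re (f x)) (Im (f x)) (Re (g x)) (Im (g x)) => a b c d.
  rewrite [leRHS]ger0_norm ?addr_ge0 ?sqr_ge0//.
  have := sqr_ge0 (a - c); have := sqr_ge0 (b - d).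
  have := sqr_ge0 (a + c); have := sqr_ge0 (b + d).
  by move=> *; rewrite ler_norml; apply/andP; split; nra.
- under eq_fun do rewrite ImMul Re_conj Im_conj.
  apply: measurable_funD; apply: measurable_funM => //.
  exact: measurableT_comp.
- move=> x _; rewrite /= lee_fin ImMul Re_conj Im_conj.
  move: (Re (f x)) (Im (f x)) (Re (g x)) (Im (g x)) => a b c d.
  rewrite [leRHS]ger0_norm ?addr_ge0 ?sqr_ge0//.
  have := sqr_ge0 (a - d); have := sqr_ge0 (b - c).
  have := sqr_ge0 (a + d); have := sqr_ge0 (b + c).
  by move=> *; rewrite ler_norml; apply/andP; split; nra.
Qed.

Lemma inner_toL2 f g (hf : sq_int f) (hg : sq_int g) :
  inner (toL2 hf) (toL2 hg) = cint01 (fun x => (f x)^*%R * g x).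
Proof.
apply: eq_ae_cint01; [exact: cintegrable_mul (L2_sq_int _) (L2_sq_int _)|
                      exact: cintegrable_mul|].
apply: (@filterS2 _ _ (ae01_filter R) _ _ _ _ (toL2K hf) (toL2K hg)).
by move=> x h1 h2 Ix; rewrite h1// h2.
Qed.

Implicit Types u v w : L2 R.

Lemma L2_addE u v : ae01 (u + v : L2 R) (fun x => u x + v x).
Proof. exact: toL2K. Qed.

Lemma L2_scaleE (a : R[i]) u : ae01 (a *: u : L2 R) (fun x => a * u x).
Proof. exact: toL2K. Qed.

Let im u v := cintegrable_mul (L2_sq_int u) (L2_sq_int v).

Lemma innerDr u v w : inner u (v + w) = inner u v + inner u w.
Proof.
rewrite /inner -cint01D//; apply: eq_ae_cint01 => //; first exact: cintegrableD.
apply: (@filterS _ _ (ae01_filter R) _ _ _ (L2_addE v w)) => x h Ix.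
by rewrite h// mulrDr.
Qed.

Lemma innerZr (a : R[i]) u v : inner u (a *: v) = a * inner u v.
Proof.
rewrite /inner -cint01Z//; apply: eq_ae_cint01 => //; first exact: cintegrableZ.
apply: (@filterS _ _ (ae01_filter R) _ _ _ (L2_scaleE a v)) => x h Ix.
by rewrite h// mulrCA.
Qed.

Lemma inner_conj u v : inner u v = ((inner v u)^*)%R.
Proof.
rewrite /inner -cint01_conj//; congr cint01; apply/funext => x.
by rewrite rmorphM /= conjCK mulrC.
Qed.

Lemma innerDl u v w : inner (u + v) w = inner u w + inner v w.
Proof. by rewrite inner_conj innerDr rmorphD /= -!inner_conj. Qed.

Lemma innerZl (a : R[i]) u v : inner (a *: u) v = (a^*)%R * inner u v.
Proof. by rewrite inner_conj innerZr rmorphM /= -inner_conj. Qed.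

Lemma innerNr u v : inner u (- v) = - inner u v.
Proof. by rewrite -scaleN1r innerZr mulN1r. Qed.

Lemma innerNl u v : inner (- u) v = - inner u v.
Proof. by rewrite inner_conj innerNr rmorphN /= -inner_conj. Qed.

Lemma innerBr u v w : inner u (v - w) = inner u v - inner u w.
Proof. by rewrite innerDr innerNr. Qed.

Lemma innerBl u v w : inner (u - v) w = inner u w - inner v w.
Proof. by rewrite innerDl innerNl. Qed.

Lemma inner0r u : inner u 0 = 0.
Proof. by rewrite -(scale0r 0) innerZr mul0r. Qed.

Lemma inner0l u : inner 0 u = 0.
Proof. by rewrite inner_conj inner0r rmorph0. Qed.

(** The squared norm. Estimates use it instead of [L2norm], so that they stay polynomial. *)
Definition N2 u : R := Re (inner u u).

Lemma inner_self u : inner u u = (N2 u)%:C.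
Proof. exact: conj_fixed (inner_conj u u). Qed.

Lemma N2E u : N2 u = \int[mu]_(x in I) (Re (u x) ^+ 2 + Im (u x) ^+ 2).
Proof.
rewrite /N2 /inner /=; apply: eq_Rintegral => x _.
by rewrite ReM Re_conj Im_conj; ring.
Qed.

Lemma N2_ge0 u : 0 <= N2 u.
Proof. by rewrite N2E; apply: Rintegral_ge0 => x _; rewrite addr_ge0 ?sqr_ge0. Qed.

Lemma N2_eq0 u : N2 u = 0 -> u = 0.
Proof.
rewrite N2E => h; apply/L2_eqP; apply: ae01_trans (ae01_sym (toL2K _)).
have [ur ui uint] := L2_sq_int u; have mI := @measurable_I01R R.
have : (\int[mu]_(x in I) `|(Re (u x) ^+ 2 + Im (u x) ^+ 2)%:E| = 0)%E.
  rewrite -[RHS]/(0%:E) -h /Rintegral fineK; last first.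
    exact: integrable_fin_num uint.
  apply: eq_integral => x _.
  by rewrite /= ger0_norm// addr_ge0 ?sqr_ge0.
move/(ae_eq_integral_abs mu mI (measurable_int _ uint)) => h0.
apply: (@filterS _ _ (ae01_filter R) _ _ _ h0) => x hx Ix.
have := hx Ix; case => /eqP; rewrite paddr_eq0 ?sqr_ge0// !sqrf_eq0.
by case/andP => /eqP r0 /eqP i0; apply: complex_ext.
Qed.

Lemma inner_eq0 u : (forall v, inner u v = 0) -> u = 0.
Proof. by move=> h; apply: N2_eq0; rewrite /N2 h. Qed.

Lemma L2normE u : L2norm u ^+ 2 = N2 u.
Proof. by rewrite /L2norm sqr_sqrtr// N2_ge0. Qed.

Lemma L2norm_lt u (e : R) : 0 < e -> (L2norm u < e) = (N2 u < e ^+ 2).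
Proof. by move=> e0; rewrite -L2normE ltr_pXn2r// nnegrE ?sqrtr_ge0 ?ltW. Qed.

Lemma N2D u v : N2 (u + v) = N2 u + N2 v + 2 * Re (inner u v).
Proof.
rewrite /N2 innerDl !innerDr (inner_conj v u) !ReD Re_conj; ring.
Qed.

Lemma N2Z (a : R[i]) u : N2 (a *: u) = (Re a ^+ 2 + Im a ^+ 2) * N2 u.
Proof.
rewrite /N2 innerZl innerZr inner_self !ReM !ImMul Re_conj Im_conj /=; ring.
Qed.

Lemma N2N u : N2 (- u) = N2 u.
Proof. by rewrite -scaleN1r N2Z /= oppr0 expr0n addr0 sqrrN expr1n mul1r. Qed.

(** The parallelogram law with the term [N2 (u - v)] dropped; it serves as the triangle inequality
    for [N2]. *)
Lemma N2_leD u v : N2 (u + v) <= 2 * (N2 u + N2 v).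
Proof.
have := N2_ge0 (u - v); have := N2D u v; have := N2D u (- v).
rewrite N2N innerNr ReN => *; lra.
Qed.

Lemma cauchy_schwarz u v :
  Re (inner u v) ^+ 2 + Im (inner u v) ^+ 2 <= N2 u * N2 v.
Proof.
set z := inner u v.
(* The squared norm of u - t z^* v for real t; the factor z^* makes the cross term real. *)
have key (t : R) : 0 <= N2 u + t ^+ 2 * (Re z ^+ 2 + Im z ^+ 2) * N2 v -
    2 * t * (Re z ^+ 2 + Im z ^+ 2).
  apply: le_trans (N2_ge0 (u + (- (t%:C * (z^*)%R)) *: v)) _.
  rewrite N2D N2Z innerZr -/z !reimE /= le_eqVlt; apply/orP; left; apply/eqP; ring.
set s := _ + _ in key *; have s0 : 0 <= s by rewrite addr_ge0 ?sqr_ge0.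
(* If [N2 v] is 0, the bound is affine in t, and t = (N2 u + 1) / s makes it negative unless s =
   0. *)
have [v0|v0] := eqVneq (N2 v) 0.
  rewrite v0 mulr0; have [//|sp] := leP s 0.
  have ts : (N2 u + 1) / s * s = N2 u + 1 by rewrite divfK// gt_eqF.
  have := key ((N2 u + 1) / s); rewrite v0 mulr0 addr0 -mulrA ts.
  by have := N2_ge0 u => *; lra.
have vp : 0 < N2 v by rewrite lt_def v0 N2_ge0.
(* The minimizing t is 1 / N2 v; multiplying [key] by [N2 v] clears the denominator. *)
have tn : (N2 v)^-1 * N2 v = 1 by rewrite mulVf.
have := mulr_ge0 (key (N2 v)^-1) (N2_ge0 v).
set t := (N2 v)^-1 in tn *; rewrite [X in 0 <= X](_ : _ = N2 u * N2 v +
  s * (t * N2 v) ^+ 2 - 2 * s * (t * N2 v)); last by ring.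
by rewrite tn => h; lra.
Qed.

End Inner.

(** * Classes of functions, indicators of intervals and dominated convergence in L_2 *)

Section Classes.
Variable R : realType.
Local Notation Re := (@complex.Re R).
Local Notation Im := (@complex.Im R).
Local Notation mu := (@lebesgue_measure R).
Local Notation I := (I01 R).

(* The class of f, or the junk value 0 if f is not square integrable. *)
Definition cls (f : R -> R[i]) : L2 R :=
  if pselect (sq_int f) is left h then toL2 h else 0.

Definition rcls (f : R -> R) : L2 R := cls (fun x => (f x)%:C).

Lemma clsE f : sq_int f -> ae01 (cls f) f.
Proof. by rewrite /cls; case: pselect => // h _; exact: toL2K. Qed.

Lemma clsK (u : L2 R) : cls u = u.
Proof. by apply/L2_eqP/clsE/L2_sq_int. Qed.

Lemma cls_eq (u : L2 R) f : sq_int f -> ae01 u f -> u = cls f.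
Proof. by move=> hf uf; apply/L2_eqP/(ae01_trans uf)/ae01_sym/clsE. Qed.

Lemma inner_cls f g : sq_int f -> sq_int g ->
  inner (cls f) (cls g) = cint01 (fun x => (f x)^*%R * g x).
Proof.
rewrite /cls; case: pselect => // hf; case: pselect => // hg _ _.
exact: inner_toL2.
Qed.

Lemma inner_clsl f (u : L2 R) : sq_int f ->
  inner (cls f) u = cint01 (fun x => (f x)^*%R * u x).
Proof. by move=> hf; rewrite -{1}(clsK u) inner_cls//; exact: L2_sq_int. Qed.

Lemma clsD f g : sq_int f -> sq_int g -> cls (fun x => f x + g x) = cls f + cls g.
Proof.
move=> hf hg; apply/esym/cls_eq; first exact: sq_intD.
apply: ae01_trans (L2_addE _ _) _; exact: ae01D (clsE hf) (clsE hg).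
Qed.

Lemma clsZ a f : sq_int f -> cls (fun x => a * f x) = a *: cls f.
Proof.
move=> hf; apply/esym/cls_eq; first exact: sq_intZ.
apply: ae01_trans (L2_scaleE _ _) _; exact: ae01Z (clsE hf).
Qed.

Lemma I01_lty : (mu I < +oo)%E.
Proof. by rewrite lebesgue_measure_itv /=; case: ifP => _; rewrite -?EFinB ltry. Qed.

Lemma integrable_bounded01 (f : R -> R) (M : R) : measurable_fun I f ->
  (forall x, I x -> `|f x| <= M) -> mu.-integrable I (EFin \o f).
Proof.
move=> mf fM; apply: measurable_bounded_integrable => //.
- exact: measurable_I01R.
- exact: I01_lty.
- exists M; split; first exact: num_real.
  by move=> x Mx y Iy; apply: le_trans (fM _ Iy) (ltW Mx).
Qed.

Lemma sq_int_real (f : R -> R) : measurable_fun I f ->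
  mu.-integrable I (EFin \o (fun x => f x ^+ 2)) -> sq_int (fun x => (f x)%:C).
Proof.
move=> mf i2; split => //=.
by under eq_fun do rewrite expr0n addr0.
Qed.

Lemma sq_int_bounded (f : R -> R) (M : R) : measurable_fun I f ->
  (forall x, I x -> `|f x| <= M) -> sq_int (fun x => (f x)%:C).
Proof.
move=> mf fM; apply: sq_int_real => //.
apply: (@integrable_bounded01 _ (M ^+ 2)); first exact: measurable_funX.
by move=> x Ix; rewrite normrX lerXn2r ?nnegrE// ?(le_trans _ (fM _ Ix)) ?fM.
Qed.

Lemma sq_intB (f g : R -> R[i]) : sq_int f -> sq_int g -> sq_int (fun x => f x - g x).
Proof. by move=> hf hg; apply: sq_intD hf (sq_intN hg). Qed.

Lemma clsB f g : sq_int f -> sq_int g -> cls (fun x => f x - g x) = cls f - cls g.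
Proof.
move=> hf hg; rewrite -scaleN1r -clsZ// -clsD//; last exact: sq_intZ.
by congr cls; apply/funext => x; rewrite mulN1r.
Qed.

Lemma N2_rclsB (f g : R -> R) :
    sq_int (fun x => (f x)%:C) -> sq_int (fun x => (g x)%:C) ->
  N2 (rcls f - rcls g) = \int[mu]_(x in I) ((f x - g x) ^+ 2).
Proof.
move=> hf hg; rewrite /N2 /rcls -clsB// inner_cls; try exact: sq_intB.
apply: eq_Rintegral => x _.
by rewrite !reimE /= !subr0 ; ring.
Qed.

(** Dominated convergence for |F - F_n|^2, which is at most (2 G)^2; hence the factor 4 in the
    majorant. *)
Lemma N2_dominated (F_ : nat -> R -> R) (F G : R -> R) :
    (forall n, measurable_fun I (F_ n)) -> measurable_fun I F ->
    measurable_fun I G ->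
    mu.-integrable I (EFin \o (fun x => G x ^+ 2)) ->
    (forall n x, I x -> `|F_ n x| <= G x) ->
    (forall x, I x -> `|F x| <= G x) ->
    (forall x, I x -> F_ ^~ x @ \oo --> F x) ->
  forall e : R, 0 < e -> exists n, N2 (rcls F - rcls (F_ n)) < e.
Proof.
move=> mF_ mF mG iG hF_ hF cF e e0; have mI := @measurable_I01R R.
have sq (H : R -> R) : measurable_fun I H -> (forall x, I x -> `|H x| <= G x) ->
    sq_int (fun x => (H x)%:C).
  move=> mH hH; apply: sq_int_real => //.
  apply: le_integrable iG => //.
    by apply/measurable_EFinP; exact: measurable_funX.
  move=> x Ix; rewrite /= lee_fin !normrX lerXn2r ?nnegrE//.
  exact: le_trans (hH _ Ix) (ler_norm _).
have mD n : measurable_fun I (fun x => (F x - F_ n x) ^+ 2).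
  by apply: measurable_funX; exact: measurable_funB.
have [|||||_ _] := @dominated_convergence _ _ R mu I mI
    (fun n x => ((F x - F_ n x) ^+ 2)%:E) (cst 0)%E (fun x => 4%:E * (G x ^+ 2)%:E)%E.
- by move=> n; apply/measurable_EFinP; exact: mD.
- exact: measurable_cst.
- apply/(@filterE _ _ (ae01_filter R)) => x Ix.
  have c0 : (fun n => F x - F_ n x) @ \oo --> (0 : R).
    by rewrite -(subrr (F x)); apply: cvgB; [exact: cvg_cst|exact: cF].
  have c1 : (fun n => (F x - F_ n x) ^+ 2) @ \oo --> (0 : R).
    by rewrite -[X in _ --> X](mul0r (0 : R)); exact: cvgM.
  by apply: cvg_EFin; [exact: nearW|exact: c1].
- exact: integrableZl.
- apply/(@filterE _ _ (ae01_filter R)) => x n Ix.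
  rewrite /= -EFinM lee_fin ger0_norm ?sqr_ge0//.
  have := hF_ n x Ix; have := hF x Ix; rewrite !ler_norml.
  by move=> /andP[? ?] /andP[? ?]; nra.
rewrite integral_cst// mul0e => /fine_cvg /cvgrPdist_lt /(_ _ e0) [n _ /(_ n)].
move=> /(_ (leqnn n)); rewrite sub0r normrN => h; exists n.
apply: le_lt_trans h; rewrite N2_rclsB.
- exact: ler_norm.
- exact: (sq _ mF hF).
- exact: (sq _ (mF_ n) (hF_ n)).
Qed.

(** For x in [0,1] this is the indicator of (0,x) as a class on (0,1). The half-line gives a meaning
    to every real x, and half-lines of this kind generate the Borel sets, as used in
    [closed_indic]. *)
Definition chi (x : R) : L2 R := rcls (\1_`]-oo, x[%classic).

Definition one : L2 R := cls (fun=> 1).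

Lemma sq_int_indic (A : set R) : measurable A ->
  sq_int (fun x => (\1_A x : R)%:C).
Proof.
move=> mA; apply: (@sq_int_bounded _ 1); first exact: measurable_indic.
by move=> x _; rewrite indicE; case: (_ \in _); rewrite ?normr1 ?normr0.
Qed.

Lemma sq_int_chi x : sq_int (fun y => (\1_(`]-oo, x[%classic) y : R)%:C).
Proof. by apply: sq_int_indic; exact: measurable_itv. Qed.

Lemma sq_int_cst (c : R[i]) : sq_int (fun _ : R => c).
Proof.
split; [exact: measurable_cst|exact: measurable_cst|].
apply: (@integrable_bounded01 _ (Re c ^+ 2 + Im c ^+ 2)); first exact: measurable_cst.
by move=> x _; rewrite ger0_norm// addr_ge0 ?sqr_ge0.
Qed.

Lemma chi0 x : x <= 0 -> chi x = 0.
Proof.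
move=> x0; apply/esym/cls_eq; first exact: sq_int_chi.
apply: ae01_trans (toL2K _) _; apply/(@filterE _ _ (ae01_filter R)) => y.
rewrite /I01 /= in_itv /= => /andP[y0 _].
by rewrite indicE memNset//= in_itv/= ltNge (le_trans x0 (ltW y0)).
Qed.

Lemma chi1 x : 1 <= x -> chi x = one.
Proof.
move=> x1; apply: cls_eq; first exact: sq_int_cst.
apply: ae01_trans (clsE (sq_int_chi x)) _; apply/(@filterE _ _ (ae01_filter R)) => y.
rewrite /I01 /= in_itv /= => /andP[_ y1].
by rewrite indicE mem_set//= in_itv/= (lt_le_trans y1 x1).
Qed.

(** The difference is the indicator of [s,t[; strict inequality occurs when this interval leaves
    (0,1) in positive length. *)
Lemma N2_chiB s t : s <= t -> N2 (chi t - chi s) <= t - s.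
Proof.
move=> st; rewrite N2_rclsB; [|exact: sq_int_chi|exact: sq_int_chi].
rewrite -lee_fin /Rintegral.
have m1 : measurable (`[s, t[%classic : set R) by exact: measurable_itv.
have e1 : (\int[mu]_(x in I) ((\1_(`]-oo, t[%classic) x - \1_(`]-oo, s[%classic) x : R) ^+ 2)%:E
    = \int[mu]_(x in I) (\1_(`[s, t[%classic) x)%:E)%E.
  apply: eq_integral => x _; congr (_%:E); rewrite !indicE !mem_setE !in_itv /=.
  case: (ltP x t) => xt; case: (ltP x s) => xs /=; rewrite ?subrr ?subr0 ?expr0n ?expr1n//.
  by have := lt_le_trans xs st; rewrite ltNge xt.
rewrite e1 integral_indic//; last exact: measurable_I01R.
have le1 : (mu (`[s, t[ `&` I) <= (t - s)%:E)%E.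
  apply: (@le_trans _ _ (mu `[s, t[%classic)).
    apply: le_measure; rewrite ?inE//; first by apply: measurableI => //; exact: measurable_I01R.
  rewrite lebesgue_measure_itv /= lte_fin; case: ifP => _; rewrite -?EFinB// lee_fin subr_ge0//.
rewrite fineK// ge0_fin_numE//; exact: le_lt_trans le1 (ltry _).
Qed.

End Classes.

(** * A closed subspace containing the indicators of intervals is all of L_2(0,1) *)

Section Density.
Variable R : realType.
Local Notation I := (I01 R).

Definition subspace (L : set (L2 R)) : Prop :=
  L 0 /\ forall (a : R[i]) u v, L u -> L v -> L (a *: u + v).

Definition N2_closed (L : set (L2 R)) : Prop :=
  forall u, (forall e : R, 0 < e -> exists2 v, L v & N2 (u - v) < e) -> L u.

Lemma subspaceD L u v : subspace L -> L u -> L v -> L (u + v).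
Proof. by case=> _ h hu hv; rewrite -[u]scale1r; exact: h. Qed.

Lemma subspaceZ L (a : R[i]) u : subspace L -> L u -> L (a *: u).
Proof. by case=> h0 h hu; rewrite -[_ *: _]addr0; exact: h. Qed.

Lemma subspaceB L u v : subspace L -> L u -> L v -> L (u - v).
Proof.
by move=> sL hu hv; rewrite -scaleN1r; apply: subspaceD => //; exact: subspaceZ.
Qed.

Lemma rclsB (f g : R -> R) :
    sq_int (fun x => (f x)%:C) -> sq_int (fun x => (g x)%:C) ->
  rcls (fun x => f x - g x) = rcls f - rcls g.
Proof.
move=> hf hg; rewrite /rcls -clsB//; congr cls; apply/funext => x.
by rewrite rmorphB.
Qed.

Lemma rclsZD (a : R) (f g : R -> R) :
    sq_int (fun x => (f x)%:C) -> sq_int (fun x => (g x)%:C) ->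
  rcls (fun x => a * f x + g x) = a%:C *: rcls f + rcls g.
Proof.
move=> hf hg; rewrite /rcls -clsZ// -clsD//; last exact: sq_intZ.
by congr cls; apply/funext => x; rewrite rmorphD rmorphM.
Qed.

Section Full.
Variable L : set (L2 R).
Hypotheses (sL : subspace L) (cL : N2_closed L).
Hypothesis Lchi : forall x : R, 0 < x < 1 -> L (chi x).

Lemma closed_one : L (one R).
Proof.
rewrite -(chi1 (lexx 1)); apply: cL => e e0.
(* The case distinction keeps the approximating index, 1 - e/2 or 1/2, inside (0,1), where [Lchi]
   applies. *)
have [e1|e1] := ltP e 1; last first.
  by exists (chi (1 / 2)); [apply: Lchi; lra|
    apply: le_lt_trans (N2_chiB _) _; lra].
by exists (chi (1 - e / 2)); [apply: Lchi; lra|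
    apply: le_lt_trans (N2_chiB _) _; lra].
Qed.

Lemma closed_chi x : L (chi x).
Proof.
have [x0|x0] := leP x 0; first by rewrite chi0//; case: sL.
have [x1|x1] := leP 1 x; first by rewrite chi1//; exact: closed_one.
by apply: Lchi; rewrite x0.
Qed.

(** Dynkin's argument: the sets whose indicator lies in L contain the half-lines, which are stable
    under intersection. They form a lambda-system: proper differences by linearity, increasing
    unions by dominated convergence and closedness. *)
Lemma closed_indic (A : set R) : measurable A -> L (rcls \1_A).
Proof.
pose H := [set A : set R | measurable A /\ L (rcls (\1_A : R -> R))].
suff: (@measurable _ R) `<=` H by move=> h /h[].
rewrite -[@measurable _ R]/((@ocitv R).-sigma.-measurable).
rewrite RGenInftyO.measurableE.
apply: lambda_system_subset.
- move=> _ _ [x ->] [y ->]; exists (Order.min x y).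
  apply/seteqP; split => z /=; rewrite !in_itv/= lt_min.
    by move=> [-> ->].
  by move=> /andP[].
- split=> //.
  + split; first exact: measurableT.
    rewrite (_ : rcls _ = one R); first exact: closed_one.
    by congr cls; apply/funext => x; rewrite indicT.
  + move=> A0 B BA [mA LA] [mB LB]; split; first exact: measurableD.
    rewrite (_ : rcls _ = rcls \1_A0 - rcls \1_B); first exact: subspaceB.
    rewrite -rclsB; [|exact: sq_int_indic|exact: sq_int_indic].
    congr rcls; apply/funext => x; rewrite !indicE in_setD.
    case: (boolP (x \in B)) => /=; last by rewrite andbT subr0.
    by rewrite inE => /BA xA; rewrite mem_set//= subrr.
  + move=> F ndF HF; have mF n : measurable (F n) by have [] := HF n.
    split; first exact: bigcupT_measurable.
    apply: cL => e e0.
    have [|||||||n hn] := @N2_dominated R (fun n => \1_(F n)) \1_(\bigcup_i F i)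
      (cst 1) _ _ _ _ _ _ _ e e0; last by exists (rcls \1_(F n)) => //; have [] := HF n.
    * by move=> n; exact: measurable_indic.
    * by apply: measurable_indic; exact: bigcupT_measurable.
    * exact: measurable_cst.
    * apply: (@integrable_bounded01 _ _ 1); first by apply: measurable_funX; exact: measurable_cst.
      by move=> x _; rewrite /= expr1n normr1.
    * by move=> n x _; rewrite indicE; case: (_ \in _); rewrite ?normr1 ?normr0.
    * by move=> x _; rewrite indicE; case: (_ \in _); rewrite ?normr1 ?normr0.
    * move=> x _; have [[N _ FN]|nF] := pselect ((\bigcup_i F i) x).
        apply: cvg_near_cst; exists N => // n /= Nn; rewrite !indicE.
        rewrite [in RHS]mem_set; last by exists N.
        by rewrite mem_set//; move/subsetPset: (ndF _ _ Nn); exact.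
      apply: cvg_near_cst; exists 0%N => // n _; rewrite !indicE !memNset//.
      by move=> Fx; apply: nF; exists n.
- by move=> _ [x ->]; split; [exact: measurable_itv|exact: closed_chi].
- by [].
Qed.

(** Square integrability is proved along with membership, since splitting off a term by [rclsZD]
    requires it of the remaining sum. *)
Lemma closed_sum_indic (A : R -> set R) (s : seq R) :
  (forall y, measurable (A y)) ->
  L (rcls (fun x => \sum_(y <- s) y * \1_(A y) x)) /\
  sq_int (fun x => (\sum_(y <- s) y * \1_(A y) x)%:C).
Proof.
move=> mA; elim: s => [|y s [Ls qs]].
  rewrite (_ : (fun _ => _) = fun=> 0); last by apply/funext => x; rewrite big_nil.
  split; last first.
    by under eq_fun do rewrite big_nil; exact: sq_int_cst.
  rewrite (_ : rcls _ = 0); first by case: sL.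
  by apply/esym/cls_eq; [exact: sq_int_cst|exact: toL2K].
under [in X in sq_int X]eq_fun do rewrite big_cons rmorphD rmorphM.
split; last by apply: sq_intD => //; apply: sq_intZ; exact: sq_int_indic.
rewrite (_ : rcls _ = y%:C *: rcls \1_(A y) +
    rcls (fun x => \sum_(y <- s) y * \1_(A y) x)).
  by case: sL => _; apply => //; exact: closed_indic.
rewrite -rclsZD//; last exact: sq_int_indic.
by congr rcls; apply/funext => x; rewrite big_cons.
Qed.

Import HBNNSimple.

Lemma closed_nneg (f : R -> R) : (forall x, 0 <= f x) ->
  sq_int (fun x => (f x)%:C) -> L (rcls f).
Proof.
move=> f0 [mf _ if2]; rewrite /= in mf; apply: cL => e e0.
have mef : measurable_fun I (EFin \o f) by apply/measurable_EFinP.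
(* Simple functions increasing to f; f itself dominates them. *)
pose g n := nnsfun_approx (@measurable_I01 R) mef n.
have gf n x : I x -> g n x <= f x.
  move=> Ix; rewrite -lee_fin /g nnsfun_approxE.
  by apply: le_approx => // y _; rewrite lee_fin.
have [|||||||n hn] := @N2_dominated R (fun n => g n) f f _ _ _ _ _ _ _ e e0.
- by move=> n; apply: measurable_funTS.
- by [].
- by [].
- by apply: eq_integrable if2; [exact: measurable_I01R|
    move=> x _; rewrite /= expr0n addr0].
- by move=> n x Ix; rewrite ger0_norm ?gf.
- by move=> x _; rewrite ger0_norm.
- move=> x Ix; apply: (fine_cvg (f := fun n => (g n x)%:E)).
  by apply: cvg_nnsfun_approx => // y _; rewrite lee_fin.
exists (rcls (g n)) => //.
rewrite (_ : rcls _ = rcls (fun x => \sum_(y <- finmap.enum_fset (fset_set (range (g n))))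
   y * \1_(g n @^-1` [set y]) x)); last first.
  by congr rcls; apply/funext => x; rewrite fimfunE fsbig_finite.
by apply: (closed_sum_indic _ _).1 => y; apply: measurable_sfunP; exact: measurable_set1.
Qed.

Theorem closed_subspace_full u : L u.
Proof.
have Lr (f : R -> R) : sq_int (fun x => (f x)%:C) -> L (rcls f).
  move=> qf; have [mf _ if2] := qf; rewrite /= in mf.
  have h (g : R -> R) : measurable_fun I g -> (forall x, `|g x| <= `|f x|) ->
      sq_int (fun x => (g x)%:C).
    move=> mg gf; apply: sq_int_real => //.
    apply: le_integrable if2; first exact: measurable_I01R.
      by apply/measurable_EFinP; exact: measurable_funX.
    move=> x _; rewrite /= lee_fin expr0n addr0 !normrX lerXn2r ?nnegrE//.
  (* The positive and negative parts of f, which [closed_nneg] handles separately. *)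
  pose p x := (`|f x| + f x) / 2; pose n x := (`|f x| - f x) / 2.
  have fabs x : - `|f x| <= f x <= `|f x| by rewrite -ler_norml.
  have mabs : measurable_fun I (fun x => `|f x|) by exact: measurableT_comp.
  have qp : sq_int (fun x => (p x)%:C).
    apply: (h p); last by move=> x; have := fabs x; rewrite /p ler_norml; lra.
    apply: measurable_funM; last exact: measurable_cst.
    exact: measurable_funD.
  have qn : sq_int (fun x => (n x)%:C).
    apply: (h n); last by move=> x; have := fabs x; rewrite /n ler_norml; lra.
    apply: measurable_funM; last exact: measurable_cst.
    exact: measurable_funB.
  rewrite (_ : f = fun x => p x - n x); last first.
    by apply/funext => x; rewrite /p /n; lra.
  rewrite rclsB//; apply: subspaceB => //; apply: closed_nneg => // x;
    by have := fabs x; rewrite /p /n; lra.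
have [mr mi ui] := L2_sq_int u.
have h (g : R -> R) : measurable_fun I g ->
   (forall x, g x ^+ 2 <= complex.Re (u x) ^+ 2 + complex.Im (u x) ^+ 2) ->
   sq_int (fun x => (g x)%:C).
  move=> mg gu; apply: sq_int_real => //.
  apply: le_integrable ui; first exact: measurable_I01R.
    by apply/measurable_EFinP; exact: measurable_funX.
  move=> x _; rewrite /= lee_fin !ger0_norm ?sqr_ge0 ?addr_ge0 ?sqr_ge0//.
have qr : sq_int (fun x => (complex.Re (u x))%:C).
  by apply: h => // x; rewrite lerDl sqr_ge0.
have qi : sq_int (fun x => (complex.Im (u x))%:C).
  by apply: h => // x; rewrite lerDr sqr_ge0.
rewrite -(clsK u) (_ : cls u = rcls (fun x => complex.Re (u x)) +
    'i *: rcls (fun x => complex.Im (u x))); last first.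
  rewrite /rcls -clsZ// -clsD//; last exact: sq_intZ.
  congr cls; apply/funext => x; case: (u x) => a b; apply: complex_ext => /=; ring.
by apply: subspaceD => //; [|apply: subspaceZ => //]; exact: Lr.
Qed.

End Full.
End Density.

(** * Primitives of square integrable functions *)

Section Volterra.
Variable R : realType.
Local Notation mu := (@lebesgue_measure R).
Local Notation I := (I01 R).
Local Notation Re := (@complex.Re R).
Local Notation Im := (@complex.Im R).
Implicit Types (f g u v : L2 R).

(** The integral of f from 0 to x, written as an inner product so that Cauchy-Schwarz applies. It is
    a genuine function on the whole line, constant to the left of 0 and to the right of 1. *)
Definition ev f (x : R) : R[i] := inner (chi x) f.

Lemma inner_le_l (M : R) f g : N2 f <= M ->
  Re (inner f g) ^+ 2 + Im (inner f g) ^+ 2 <= M * N2 g.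
Proof.
by move=> h; apply: le_trans (cauchy_schwarz _ _) _; rewrite ler_wpM2r ?N2_ge0.
Qed.

Lemma N2_chi x : N2 (chi x : L2 R) <= 1.
Proof.
have [x0|x0] := leP x 0; first by rewrite chi0// /N2 inner0r.
have [x1|x1] := leP x 1.
  by have := N2_chiB (ltW x0); rewrite (chi0 (lexx 0)) subr0; lra.
have := @N2_chiB R 0 1 ler01; rewrite (chi0 (lexx 0)) subr0.
by rewrite (chi1 (lexx 1)) (chi1 (ltW x1)); lra.
Qed.

Lemma ev_holder f s t : Re (ev f t - ev f s) ^+ 2 + Im (ev f t - ev f s) ^+ 2
  <= `|t - s| * N2 f.
Proof.
rewrite /ev -innerBl; apply: inner_le_l.
have [st|/ltW ts] := leP s t; first by rewrite ger0_norm ?subr_ge0// N2_chiB.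
by rewrite -N2N opprB distrC ger0_norm ?subr_ge0// N2_chiB.
Qed.

Lemma continuous_sq_holder (h : R -> R) (M : R) : 0 <= M ->
  (forall s t, (h t - h s) ^+ 2 <= `|t - s| * M) -> continuous h.
Proof.
move=> M0 hh s; apply/cvgrPdist_lt => e e0.
(* M + 1 instead of M, because M may be 0. *)
have d0 : 0 < e ^+ 2 / (M + 1) by rewrite divr_gt0 ?exprn_gt0// ltr_wpDl.
near=> t; rewrite -[ltRHS]ger0_norm ?ltW// -ltr_sqr ?nnegrE//.
rewrite !real_normK ?num_real//.
apply: le_lt_trans (hh _ _) _.
have : `|s - t| < e ^+ 2 / (M + 1) by near: t; apply: cvgr_dist_lt.
rewrite ltr_pdivlMr ?ltr_wpDl// => h1.
by have := normr_ge0 (s - t); nra.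
Unshelve. all: by end_near. Qed.

Lemma continuous_Re_ev f : continuous (fun x => Re (ev f x)).
Proof.
apply: (continuous_sq_holder (N2_ge0 f)) => s t.
have := ev_holder f s t; move: (ev f t) (ev f s) => z w.
by apply: le_trans; rewrite ReD ReN lerDl sqr_ge0.
Qed.

Lemma continuous_Im_ev f : continuous (fun x => Im (ev f x)).
Proof.
apply: (continuous_sq_holder (N2_ge0 f)) => s t.
have := ev_holder f s t; move: (ev f t) (ev f s) => z w.
by apply: le_trans; rewrite ImD ImN lerDr sqr_ge0.
Qed.

Lemma ev_bound f x : Re (ev f x) ^+ 2 + Im (ev f x) ^+ 2 <= N2 f.
Proof. by rewrite -[leRHS]mul1r; apply: inner_le_l; exact: N2_chi. Qed.

Lemma measurable_continuous01 (h : R -> R) : continuous h -> measurable_fun I h.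
Proof. by move=> ch; apply: measurable_funTS; exact: continuous_measurable_fun. Qed.

Lemma sq_int_ev f : sq_int (ev f).
Proof.
have mr := measurable_continuous01 (@continuous_Re_ev f).
have mi := measurable_continuous01 (@continuous_Im_ev f).
split => //; apply: (@integrable_bounded01 _ _ (N2 f)).
  by apply: measurable_funD; exact: measurable_funX.
by move=> x _; rewrite ger0_norm ?ev_bound// addr_ge0 ?sqr_ge0.
Qed.

(** The Volterra operator. *)
Definition V f : L2 R := cls (ev f).

Lemma V_linear (a : R[i]) f g : V (a *: f + g) = a *: V f + V g.
Proof.
rewrite /V -clsZ -?clsD; try apply: sq_intZ; try exact: sq_int_ev.
by congr cls; apply/funext => x; rewrite /ev innerDr innerZr.
Qed.

Lemma VD f g : V (f + g) = V f + V g.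
Proof. by rewrite -[f]scale1r V_linear !scale1r. Qed.

Lemma V0 : V 0 = 0.
Proof. by have := V_linear (-1) 0 0; rewrite scaler0 addr0 scaleN1r addNr. Qed.

Lemma VZ (a : R[i]) f : V (a *: f) = a *: V f.
Proof. by rewrite -[a *: f]addr0 V_linear V0 addr0. Qed.

Lemma VN f : V (- f) = - V f.
Proof. by rewrite -scaleN1r VZ scaleN1r. Qed.

Lemma Rintegral01_le (h : R -> R) (M : R) : measurable_fun I h ->
  (forall x, I x -> `|h x| <= M) -> \int[mu]_(x in I) h x <= M.
Proof.
move=> mh hM; have mI := @measurable_I01R R.
have -> : M = \int[mu]_(x in I) M.
  have mu1 : mu I = 1%E.
    by rewrite lebesgue_measure_itv /= lte_fin ltr01 oppr0 adde0.
  transitivity (M * fine (mu I)); first by rewrite mu1 mulr1.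
  by rewrite Rintegral_cst.
apply: le_Rintegral => //.
- exact: (integrable_bounded01 mh hM).
- apply: (@integrable_bounded01 _ _ `|M|); first exact: measurable_cst.
  by [].
- by move=> x Ix; apply: le_trans (ler_norm _) (hM _ Ix).
Qed.

(** The pointwise bound [ev_bound] is integrated over an interval of length 1. *)
Lemma N2_V f : N2 (V f) <= N2 f.
Proof.
rewrite /N2 /V inner_cls; try exact: sq_int_ev.
apply: Rintegral01_le.
  have [i _] := cintegrable_mul (sq_int_ev f) (sq_int_ev f).
  by apply/measurable_EFinP; exact: measurable_int i.
move=> x _; rewrite !reimE.
rewrite (_ : _ - _ = Re (ev f x) ^+ 2 + Im (ev f x) ^+ 2); last by ring.
by rewrite ger0_norm ?ev_bound// addr_ge0 ?sqr_ge0.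
Qed.

End Volterra.

(** * Integration by parts for primitives *)

Section IntegrationByParts.
Variable R : realType.
Local Notation mu := (@lebesgue_measure R).
Local Notation I := (I01 R).
Local Notation Re := (@complex.Re R).
Local Notation Im := (@complex.Im R).
Implicit Types (f g u v : L2 R).

Lemma sq_int_continuous (h : R -> R) : continuous h -> sq_int (fun x => (h x)%:C).
Proof.
move=> ch.
have [|c _ hc] := @EVT_max R (fun x => `|h x|) 0 1 ler01.
  apply: continuous_subspaceT => x; apply: continuous_comp; first exact: ch.
  exact: norm_continuous.
apply: (@sq_int_bounded _ _ `|h c|); first exact: measurable_continuous01.
move=> x; rewrite /I01 /= in_itv /= => /andP[x0 x1].
by apply: hc; rewrite in_itv /= !ltW.
Qed.

Lemma inner_real (h k : R -> R) :
    sq_int (fun x => (h x)%:C) -> sq_int (fun x => (k x)%:C) ->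
  inner (rcls h) (rcls k) = (\int[mu]_(x in I) (h x * k x))%:C.
Proof.
move=> hh hk; rewrite inner_cls//; apply: complex_ext => /=.
  by apply: eq_Rintegral => x _ /=; ring.
transitivity (\int[mu]_(x in I) (0 : R)).
  by apply: eq_Rintegral => x _ /=; ring.
by rewrite /Rintegral integral0.
Qed.

(** The bridge from [ev] to classical calculus: it evaluates the primitives of powers, of test
    function derivatives and of trapezoids. *)
Lemma ev_FTC (F : R -> R) (x : R) : (forall y, derivable F y 1) ->
  continuous (derive1 F) -> 0 <= x <= 1 ->
  ev (rcls (derive1 F)) x = (F x - F 0)%:C.
Proof.
move=> dF cF /andP[x0 x1].
rewrite /ev inner_real; [|exact: sq_int_chi|exact: sq_int_continuous].
congr (_%:C); have mI := @measurable_I01R R.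
(* The case x = 0 is separate: the fundamental theorem is applied on an interval with 0 < x. *)
move: x0; rewrite le_eqVlt => /predU1P[<-|x0].
  rewrite subrr; under eq_Rintegral => y.
    rewrite inE /I01 /= in_itv /= => /andP[y0 _].
    rewrite indicE memNset /=; last by rewrite in_itv /= ltNge ltW.
    rewrite mul0r; over.
  by rewrite /Rintegral integral0.
have cx : {within `[0, x], continuous (derive1 F)}.
  by apply: continuous_subspaceT.
have contF : continuous F.
  by move=> y; apply: differentiable_continuous; apply/derivable1_diffP; exact: dF.
have ix : mu.-integrable `[0, x] (EFin \o derive1 F).
  by apply: continuous_compact_integrable => //; exact: segment_compact.
transitivity (\int[mu]_(y in I `&` `]-oo, x[) derive1 F y).
  rewrite Rintegral_mkcondr; apply: eq_Rintegral => y _.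
  by rewrite /patch indicE; case: ifP => _; rewrite ?mul1r ?mul0r.
rewrite (_ : I `&` `]-oo, x[ = `]0, x[%classic); last first.
  apply/seteqP; split => y /=; rewrite /I01 /= !in_itv /=.
    by move=> [/andP[-> _] ->].
  by move=> /andP[-> yx]; rewrite yx (lt_le_trans yx x1).
rewrite Rintegral_itv_bndo_bndc; last first.
  apply: integrableS ix; [exact: measurable_itv|exact: measurable_itv|].
  by move=> y /=; rewrite !in_itv /= => /andP[h1 h2]; apply/andP; split=> //; exact: ltW.
rewrite Rintegral_itv_obnd_cbnd; last first.
  apply: integrableS ix; [exact: measurable_itv|exact: measurable_itv|].
  by move=> y /=; rewrite !in_itv /= => /andP[h1 h2]; apply/andP; split=> //; exact: ltW.
rewrite /Rintegral (@continuous_FTC2 _ (derive1 F) F)//=.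
split => //.
- by apply: cvg_at_right_filter; exact: contF.
- by apply: cvg_at_left_filter; exact: contF.
Qed.

Lemma inner_chi (a b : R) : 0 <= a <= b -> b <= 1 -> inner (chi a) (chi b : L2 R) = a%:C.
Proof.
move=> /andP[a0 ab] b1.
have dF y : derivable (@id R) y 1 by exact: derivable_id.
have d1 : derive1 (@id R) = cst 1.
  by apply/funext => y; rewrite derive1E derive_id.
have h (s : R) : 0 <= s <= 1 -> inner (chi s) (one R) = s%:C.
  move=> s01; have := @ev_FTC id s dF; rewrite d1 /ev /= subr0; apply => //.
  exact: cst_continuous.
rewrite -(h a) ?a0 ?(le_trans ab)//.
rewrite -(chi1 (lexx 1)) !inner_real; try exact: sq_int_chi.
congr (_%:C); apply: eq_Rintegral => y; rewrite inE /I01 /= in_itv /= => /andP[y0 y1].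
rewrite !indicE !mem_setE !in_itv /= y1.
by case: (ltP y a) => ya; rewrite ?(lt_le_trans ya ab)// !mul0r.
Qed.

Definition ibp_defect f g : R[i] :=
  inner (V f) g + inner f (V g) - ((inner (one R) f)^*)%R * inner (one R) g.

Lemma ibp_defect_conj f g : ((ibp_defect f g)^*)%R = ibp_defect g f.
Proof.
rewrite /ibp_defect !rmorphD rmorphN rmorphM /= conjCK -!inner_conj.
by rewrite (addrC (inner g _)) (mulrC (inner (one R) f)).
Qed.

Definition bounded_form (phi : L2 R -> R[i]) : Prop :=
  exists C : R, forall u, Re (phi u) ^+ 2 + Im (phi u) ^+ 2 <= C * N2 u.

Lemma bounded_formD phi psi : bounded_form phi -> bounded_form psi ->
  bounded_form (fun u => phi u + psi u).
Proof.
move=> [C hC] [D hD]; exists (2 * C + 2 * D) => u.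
have := hC u; have := hD u; rewrite ReD ImD.
move: (Re (phi u)) (Im (phi u)) (Re (psi u)) (Im (psi u)) => a b c d h1 h2.
have := sqr_ge0 (a - c); have := sqr_ge0 (b - d); nra.
Qed.

Lemma bounded_formZ a phi : bounded_form phi -> bounded_form (fun u => a * phi u).
Proof.
move=> [C hC]; exists ((Re a ^+ 2 + Im a ^+ 2) * C) => u.
have := hC u; rewrite ReM ImMul.
move: (Re (phi u)) (Im (phi u)) (Re a) (Im a) => x y b c h1.
have := ler_wpM2l (addr_ge0 (sqr_ge0 b) (sqr_ge0 c)) h1; nra.
Qed.

Lemma bounded_form_inner v : bounded_form (fun u => inner u v).
Proof. by exists (N2 v) => u; rewrite mulrC; exact: cauchy_schwarz. Qed.

Lemma bounded_form_V v : bounded_form (fun u => inner (V u) v).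
Proof.
exists (N2 v) => u; rewrite mulrC; apply: inner_le_l; exact: N2_V.
Qed.

(** The kernel of a bounded antilinear form is a closed subspace, so [closed_subspace_full] applies.
    Antilinearity is what the first argument of [inner] provides. *)
Lemma antilinear_vanish (phi : L2 R -> R[i]) :
    (forall a u v, phi (a *: u + v) = (a^*)%R * phi u + phi v) ->
    bounded_form phi -> (forall x : R, 0 < x < 1 -> phi (chi x) = 0) ->
  forall u, phi u = 0.
Proof.
move=> lin [C hC] hchi.
have p0 : phi 0 = 0.
  by have := lin (-1) 0 0; rewrite scaler0 add0r rmorphN rmorph1 mulN1r addNr.
apply: (@closed_subspace_full _ [set u | phi u = 0]) => //.
  by split=> // a u v /= hu hv; rewrite lin hu hv mulr0 addr0.
move=> u hu /=.
have key e : 0 < e -> Re (phi u) ^+ 2 + Im (phi u) ^+ 2 <= `|C| * e.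
  move=> /hu [v pv uv]; have -> : phi u = phi (u - v).
    have := lin (-1) v u; rewrite scaleN1r pv mulr0 add0r addrC => ->.
    by [].
  apply: le_trans (hC _) _; apply: le_trans (ler_norm _) _.
  by rewrite normrM ler_wpM2l// ger0_norm ?N2_ge0// ltW.
have z : Re (phi u) ^+ 2 + Im (phi u) ^+ 2 <= 0.
  apply/ler_addgt0Pl => e e0; rewrite addr0.
  have c1 : 0 < `|C| + 1 by rewrite ltr_wpDl.
  apply: le_trans (key (e / (`|C| + 1)) _) _; first by rewrite divr_gt0.
  by rewrite mulrCA; apply: ler_piMr; [exact: ltW|rewrite ler_pdivrMr// mul1r lerDl].
have r0 := sqr_ge0 (Re (phi u)); have i0 := sqr_ge0 (Im (phi u)).
apply: complex_ext; apply/eqP; rewrite -sqrf_eq0; apply/eqP => /=; lra.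
Qed.

(** Direct computation: the two inner products are a^2/2 + a (b - a) and a^2/2, with sum a b, the
    product of the integrals of the two indicators. *)
Lemma ibp_chi (a b : R) : 0 <= a <= b -> b <= 1 ->
  ibp_defect (chi a) (chi b) = 0.
Proof.
move=> /[dup] ab0 /andP[a0 ab] b1; have a1 := le_trans ab b1.
have b0 := le_trans a0 ab.
have innA (s : R) : 0 <= s <= 1 -> inner (one R) (chi s) = s%:C.
  move=> /andP[s0 s1]; rewrite inner_conj -(chi1 (lexx 1)) inner_chi ?s0 ?s1 //.
  by apply: complex_ext; rewrite ?reimE /= ?oppr0.
pose sq (x : R) : R := x ^+ 2 / 2.
have dsq y : derivable sq y 1 by [].
have d1 : derive1 sq = id.
  apply/funext => y; rewrite derive1E /sq.
  rewrite (_ : (fun _ => _) = (fun x : R => 2^-1 *: (x ^+ 2))); last first.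
    by apply/funext => x; rewrite /= [RHS]mulrC.
  rewrite deriveZ//= exp_derive /= expr1 scaler1; rewrite -[_ *: _]/(_ * _).
  by rewrite -[2 *: y]/(2 * y); lra.
have cid : continuous (@id R) by move=> x; exact: cvg_id.
have idq := sq_int_continuous cid.
have evid (s : R) : 0 <= s <= 1 -> inner (chi s) (rcls (@id R)) = (s ^+ 2 / 2)%:C.
  move=> s01; have := @ev_FTC sq s dsq; rewrite d1 /ev /sq => -> //.
  by rewrite expr0n mul0r subr0.
(* On (0,s) with s <= t the primitive of [chi t] is the identity, whose own primitive is [sq]. *)
have Vchib (s t : R) : 0 <= s -> s <= t -> t <= 1 ->
    inner (chi s) (V (chi t)) = (s ^+ 2 / 2)%:C.
  move=> s0 st t1; rewrite -evid ?s0 ?(le_trans st)//.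
  rewrite /V !inner_cls; try exact: sq_int_ev; try exact: sq_int_chi; last by [].
  have e x : I x -> ((\1_(`]-oo, s[%classic) x : R)%:C)^*%R * ev (chi t) x =
     ((\1_(`]-oo, s[%classic) x : R)%:C)^*%R * (x%:C).
    rewrite /I01 /= in_itv /= => /andP[x0 x1].
    rewrite indicE mem_setE in_itv /=; case: (ltP x s) => xs; last first.
      by rewrite rmorph0 !mul0r.
    by rewrite /ev inner_chi ?(ltW x0) ?(ltW (lt_le_trans xs st)).
  by rewrite /cint01; congr (_ +i* _); apply: eq_Rintegral => x; rewrite inE => /e ->.
rewrite /ibp_defect !innA ?a0 ?b0// Vchib//.
have -> : inner (V (chi a)) (chi b) = (a ^+ 2 / 2 + a * (b - a))%:C.
  have -> : (chi b : L2 R) = chi a + (chi b - chi a) by rewrite addrC subrK.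
  rewrite innerDr (inner_conj _ (chi a)) Vchib//.
  (* On [a,b[ the primitive of [chi a] is the constant a, so it may be replaced by a multiple of
     [one]. *)
  rewrite (_ : inner (V (chi a)) (chi b - chi a) = (a * (b - a))%:C); last first.
    rewrite inner_conj; transitivity ((inner (chi b - chi a) (a%:C *: one R))^*)%R.
      congr (_^*)%R; rewrite /chi -rclsB; try exact: sq_int_chi.
      rewrite /rcls /V /one -clsZ ?inner_cls; try exact: sq_int_cst; try exact: sq_int_ev;
        try exact: (sq_intZ _ (sq_int_cst _));
        try by (under eq_fun do rewrite rmorphB; exact: sq_intB (sq_int_chi _) (sq_int_chi _)).
      + have e x : I x -> ((\1_(`]-oo, b[%classic) x - \1_(`]-oo, a[%classic) x : R)%:C)^*%R
             * ev (rcls \1_(`]-oo, a[)) x =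
          ((\1_(`]-oo, b[%classic) x - \1_(`]-oo, a[%classic) x : R)%:C)^*%R * (a%:C * 1).
          rewrite /I01 /= in_itv /= => /andP[x0 x1].
          rewrite !indicE !mem_setE !in_itv /=; case: (ltP x a) => xa.
            by rewrite (lt_le_trans xa ab) subrr rmorph0 !mul0r.
          congr (_ * _); rewrite mulr1 /ev inner_conj inner_chi ?a0 ?(ltW x1)//.
          by apply: complex_ext; rewrite ?reimE /= ?oppr0.
        by rewrite /cint01; congr (_ +i* _); apply: eq_Rintegral => x; rewrite inE => /e ->.
    rewrite innerZr innerBl inner_conj innA ?b0// (inner_conj (chi a)) innA ?a0//.
    by apply: complex_ext; rewrite ?reimE /= ?(mul0r, oppr0, subr0, addr0, mulr0).
  apply: complex_ext; rewrite ?reimE /= ?(mul0r, mulr0, oppr0, subr0, addr0) //.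
apply: complex_ext; rewrite ?reimE /= ?(mul0r, mulr0, oppr0, subr0, addr0) //. by field.
Qed.

(** The defect is a bounded antilinear form in its first argument, so [van] reduces that argument to
    indicators. Conjugation exchanges the arguments, so [van] applies a second time; one more
    exchange orders the endpoints x and y. *)
Theorem integration_by_parts f g :
  inner (V f) g + inner f (V g) = ((inner (one R) f)^*)%R * inner (one R) g.
Proof.
suff: ibp_defect f g = 0 by move/eqP; rewrite subr_eq0 => /eqP.
have van k : (forall x : R, 0 < x < 1 -> ibp_defect (chi x) k = 0) ->
    forall u, ibp_defect u k = 0.
  move=> h; apply: antilinear_vanish => //.
  - move=> a u v; rewrite /ibp_defect V_linear !innerDl !innerZl innerDr innerZr.
    rewrite rmorphD rmorphM /=.
    move: (inner (V u) k) (inner (V v) k) (inner u (V k)) (inner v (V k)).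
    move: (inner (one R) u) (inner (one R) v) (inner (one R) k) => *; ring.
  - rewrite /ibp_defect; apply: bounded_formD.
      by apply: bounded_formD; [exact: bounded_form_V|exact: bounded_form_inner].
    have [C hC] := bounded_formZ (- inner (one R) k) (bounded_form_inner (one R)).
    exists C => u; rewrite [_ * inner _ k]mulrC -mulNr -(inner_conj u); exact: hC.
apply: (van) => x /andP[x0 x1].
rewrite -ibp_defect_conj van ?rmorph0// => y /andP[y0 y1].
have [xy|/ltW yx] := leP x y.
  by rewrite -ibp_defect_conj ibp_chi ?rmorph0 ?(ltW x0) ?(ltW y1).
by rewrite ibp_chi ?(ltW y0) ?(ltW x1).
Qed.

End IntegrationByParts.

(** * Trapezoids approximating the indicators of intervals *)

Section Trapezoid.
Variable R : realType.
Local Notation mu := (@lebesgue_measure R).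
Local Notation I := (I01 R).
Implicit Types (f g u v : L2 R) (x y a b l : R).

(** This is max(y, 0), in a form whose continuity is immediate. *)
Definition pos_part y : R := (`|y| + y) / 2.

(* pos_part y ^+ 2 / 2, a C^1 primitive of pos_part. *)
Definition pos_sq y : R := (y * `|y| + y ^+ 2) / 4.

Lemma pos_part_le0 y : y <= 0 -> pos_part y = 0.
Proof. by move=> y0; rewrite /pos_part ler0_norm// addNr mul0r. Qed.

Lemma pos_part_ge0 y : 0 <= y -> pos_part y = y.
Proof. by move=> y0; rewrite /pos_part ger0_norm//; lra. Qed.

Lemma pos_sq_le0 y : y <= 0 -> pos_sq y = 0.
Proof. by move=> y0; rewrite /pos_sq ler0_norm//; lra. Qed.

Lemma pos_sq_ge0 y : 0 <= y -> pos_sq y = y ^+ 2 / 2.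
Proof. by move=> y0; rewrite /pos_sq ger0_norm//; lra. Qed.

Lemma continuous_pos_part : continuous pos_part.
Proof.
move=> y; apply: cvgM; last exact: cvg_cst.
by apply: cvgD; [exact: norm_continuous|exact: cvg_id].
Qed.

(** The difference quotient is within |h| of [pos_part y], checked in the four sign cases of y and h
    + y. *)
Lemma is_derive_pos_sq y : is_derive y 1 pos_sq (pos_part y).
Proof.
have key : h^-1 * (pos_sq (h + y) - pos_sq y) @[h --> 0^'] --> pos_part y.
  apply/cvgrPdist_le => e e0; near=> h.
  have h0 : h != 0 by near: h; exact: nbhs_dnbhs_neq.
  have he : `|h| <= e by near: h; apply: dnbhs0_le.
  apply: le_trans he.
  have nh : 0 < `|h| by rewrite normr_gt0.
  rewrite -(ler_pM2r nh) -normrM mulrBl [_^-1 * _ * _]mulrAC mulVf// mul1r.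
  rewrite -expr2 real_normK ?num_real//.
  rewrite ler_norml; apply/andP.
  have [y0|y0] := leP 0 y; have [z0|z0] := leP 0 (h + y).
  - by rewrite pos_part_ge0// !pos_sq_ge0//; split; nra.
  - by rewrite pos_part_ge0// (pos_sq_ge0 y0) (pos_sq_le0 (ltW z0)); split; nra.
  - by rewrite (pos_part_le0 (ltW y0)) (pos_sq_ge0 z0) (pos_sq_le0 (ltW y0)); split; nra.
  - by rewrite (pos_part_le0 (ltW y0)) (pos_sq_le0 (ltW z0)) (pos_sq_le0 (ltW y0)); split; nra.
have key' : h^-1 *: ((pos_sq \o shift y) (h *: 1) - pos_sq y) @[h --> 0^'] --> pos_part y.
  by under eq_fun do rewrite /= /shift /= [_ *: 1]mulr1.
split; first by apply/cvg_ex; exists (pos_part y).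
exact: cvg_lim key'.
Unshelve. all: by end_near. Qed.

(** For 0 < l and 3 l <= b: zero up to l, rising to 1 on [l, 2 l], equal to 1 up to b - l, falling
    to 0 at b and zero from there on. *)
Definition trap b l x : R := l^-1 * (pos_part (x - l) - pos_part (x - 2 * l)
  + pos_part (x - b) - pos_part (x - (b - l))).

Definition trap_prim b l x : R := l^-1 * (pos_sq (x - l) - pos_sq (x - 2 * l)
  + pos_sq (x - b) - pos_sq (x - (b - l))).

Lemma is_derive_shift a x : is_derive x 1 (fun x => pos_sq (x - a)) (pos_part (x - a)).
Proof.
have h : is_derive x 1 (fun x => x - a) (1 : R).
  by apply: is_derive_eq; rewrite subr0.
have := @is_derive1_comp _ pos_sq (fun x => x - a) x _ _ (is_derive_pos_sq (x - a)) h.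
by rewrite mulr1.
Qed.

Lemma is_derive_trap b l x : is_derive x 1 (trap_prim b l) (trap b l x).
Proof.
have := is_deriveZ l^-1 (is_deriveB (is_deriveD (is_deriveB (is_derive_shift l x)
  (is_derive_shift (2 * l) x)) (is_derive_shift b x)) (is_derive_shift (b - l) x)).
by [].
Qed.

Lemma continuous_trap b l : continuous (trap b l).
Proof.
move=> x; have h a : {for x, continuous (fun x => pos_part (x - a))}.
  apply: (@continuous_comp _ _ _ (fun x => x - a) pos_part).
    by apply: cvgB; [exact: cvg_id|exact: cvg_cst].
  exact: continuous_pos_part.
apply: cvgM; first exact: cvg_cst.
by apply: cvgB; [apply: cvgD; [apply: cvgB|]|]; exact: h.
Qed.

Lemma trap_prim_le b l x : 0 < l -> 3 * l <= b -> x <= l -> trap_prim b l x = 0.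
Proof. by move=> *; rewrite /trap_prim !pos_sq_le0; lra. Qed.

Lemma trap_prim_ge b l x : 0 < l -> 3 * l <= b -> b <= x -> trap_prim b l x = b - 2 * l.
Proof.
move=> l0 lb bx; rewrite /trap_prim !pos_sq_ge0; try lra.
by field; rewrite gt_eqF.
Qed.

Lemma derive1_trap b l : derive1 (trap_prim b l) = trap b l.
Proof.
by apply/funext => x; rewrite derive1E; have [_ ->] := is_derive_trap b l x.
Qed.

Lemma derivable_trap b l x : derivable (trap_prim b l) x 1.
Proof. by have [] := is_derive_trap b l x. Qed.

Lemma sq_int_trap b l : sq_int (fun x => (trap b l x)%:C).
Proof. by apply: sq_int_continuous; exact: continuous_trap. Qed.

(** The derivative of the trapezoid: 1/l on the rising flank and -1/l on the falling one, with total
    integral 0. *)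
Definition trap_step b l : L2 R :=
  (l^-1)%:C *: (chi (2 * l) - chi l - chi b + chi (b - l)).

Lemma ev_chi a x : 0 <= a <= 1 -> 0 <= x <= 1 ->
  ev (chi a) x = (x - pos_part (x - a))%:C.
Proof.
move=> /andP[a0 a1] /andP[x0 x1]; rewrite /ev; have [xa|/ltW ax] := leP x a.
  by rewrite inner_chi ?x0// pos_part_le0 ?subr0// subr_le0.
rewrite inner_conj inner_chi ?a0// pos_part_ge0 ?subr_ge0//.
by apply: complex_ext; rewrite ?reimE /= ?oppr0//; ring.
Qed.

Lemma V_trap_step b l : 0 < l -> 3 * l <= b -> b <= 1 ->
  V (trap_step b l) = rcls (trap b l).
Proof.
move=> l0 lb b1; apply: cls_eq; first exact: sq_int_trap.
apply: ae01_trans (clsE (sq_int_ev _)) _.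
apply/(@filterE _ _ (ae01_filter R)) => x; rewrite /I01 /= in_itv /= => /andP[x0 x1].
have [c1 c2] : 0 <= 2 * l <= 1 /\ 0 <= l <= 1 by split; lra.
have [c3 c4] : 0 <= b <= 1 /\ 0 <= b - l <= 1 by split; lra.
have cx : 0 <= x <= 1 by rewrite !ltW.
rewrite /ev /trap_step innerZr !(innerDr, innerNr) -!/(ev _ x) !ev_chi//.
rewrite /trap; move: (pos_part _) (pos_part _) (pos_part _) (pos_part _) => p q r s.
by apply: complex_ext => /=; ring.
Qed.

Lemma inner_one_chi a : 0 <= a <= 1 -> inner (one R) (chi a) = a%:C.
Proof.
move=> /andP[a0 a1]; rewrite inner_conj -(chi1 (lexx 1)) inner_chi ?a0 //.
by apply: complex_ext; rewrite ?reimE /= ?oppr0.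
Qed.

Lemma trap_step_orth b l : 0 < l -> 3 * l <= b -> b <= 1 ->
  inner (one R) (trap_step b l) = 0.
Proof.
move=> l0 lb b1.
have [c1 c2] : 0 <= 2 * l <= 1 /\ 0 <= l <= 1 by split; lra.
have [c3 c4] : 0 <= b <= 1 /\ 0 <= b - l <= 1 by split; lra.
rewrite /trap_step innerZr !(innerDr, innerNr).
rewrite !inner_one_chi//.
by apply: complex_ext => /=; ring.
Qed.

Lemma trap_bounds b l x : 0 < l -> 3 * l <= b ->
  [/\ 0 <= trap b l x <= 1, b <= x -> trap b l x = 0 &
      2 * l <= x <= b - l -> trap b l x = 1].
Proof.
move=> l0 lb; have li : l^-1 * l = 1 by rewrite mulVf ?gt_eqF.
have lV : 0 < l^-1 by rewrite invr_gt0.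
split.
- suff : 0 <= pos_part (x - l) - pos_part (x - 2 * l) + pos_part (x - b)
    - pos_part (x - (b - l)) <= l.
    move=> /andP[h1 h2]; apply/andP; split; first by rewrite /trap mulr_ge0// ltW.
    by rewrite /trap -[leRHS]li ler_pM2l.
  have [h1|h1] := leP x l.
    by rewrite !pos_part_le0; lra.
  have [h2|h2] := leP x (2 * l).
    by rewrite (@pos_part_ge0 (x - l)) ?(@pos_part_le0 (x - 2 * l)) ?(@pos_part_le0 (x - b)) ?(@pos_part_le0 (x - (b - l))); lra.
  have [h3|h3] := leP x (b - l).
    by rewrite (@pos_part_ge0 (x - l)) ?(@pos_part_ge0 (x - 2 * l)) ?(@pos_part_le0 (x - b)) ?(@pos_part_le0 (x - (b - l))); lra.
  have [h4|h4] := leP x b.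
    by rewrite (@pos_part_ge0 (x - l)) ?(@pos_part_ge0 (x - 2 * l)) ?(@pos_part_le0 (x - b)) ?(@pos_part_ge0 (x - (b - l))); lra.
  by rewrite !pos_part_ge0; lra.
- by move=> bx; rewrite /trap !pos_part_ge0; try lra; ring.
- move=> /andP[h1 h2]; rewrite /trap (@pos_part_ge0 (x - l)) ?(@pos_part_ge0 (x - 2 * l))
    ?(@pos_part_le0 (x - b)) ?(@pos_part_le0 (x - (b - l))); try lra.
Qed.

(** The difference has values in [0,1] and vanishes on (0,1) except on (0, 2 l) and (b - l, b), of
    total length 3 l. *)
Lemma N2_chi_trap b l : 0 < l -> 3 * l <= b -> b <= 1 ->
  N2 (chi b - rcls (trap b l)) <= 3 * l.
Proof.
move=> l0 lb b1; rewrite N2_rclsB; [|exact: sq_int_chi|exact: sq_int_trap].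
have mI := @measurable_I01R R.
have [c1 c2] : 0 <= 2 * l <= 1 /\ 0 <= l <= 1 by split; lra.
have [c3 c4] : 0 <= b <= 1 /\ 0 <= b - l <= 1 by split; lra.
pose ind a x : R := \1_(`]-oo, a[%classic) x.
have mind a : measurable_fun I (ind a) by apply: measurable_indic; exact: measurable_itv.
(* The bound 3 l is written as the integral of the step function that majorizes the squared
   difference pointwise. *)
have e1 : (3 * l)%:C = inner (one R) (chi (2 * l) + (chi b - chi (b - l))).
  rewrite !(innerDr, innerNr) !inner_one_chi//.
  by apply: complex_ext => /=; ring.
have e2 : chi (2 * l) + (chi b - chi (b - l)) =
    rcls (fun x => 1 * ind (2 * l) x + (ind b x - ind (b - l) x)).
  rewrite rclsZD; [|exact: sq_int_chi|].
    by rewrite scale1r rclsB//; exact: sq_int_chi.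
  by under eq_fun do rewrite rmorphB; exact: sq_intB (sq_int_chi _) (sq_int_chi _).
have bd a x : 0 <= ind a x <= 1.
  by rewrite /ind indicE; case: (_ \in _); rewrite ?lexx ler01.
have e3 : 3 * l = \int[mu]_(x in I) (1 * ind (2 * l) x + (ind b x - ind (b - l) x)).
  have := congr1 (@complex.Re R) e1; rewrite e2 -[one R]/(rcls (cst 1)) inner_real.
  - by rewrite [LHS]/= => ->; apply: eq_Rintegral => x _; rewrite /cst mul1r.
  - exact: (sq_int_cst 1%:C).
  - under eq_fun do rewrite rmorphD rmorphM rmorphB.
    by apply: sq_intD; [apply: sq_intZ|apply: sq_intB]; exact: sq_int_chi.
rewrite [leRHS]e3; apply: le_Rintegral => //.
- apply: (@integrable_bounded01 _ _ 1).
    apply: measurable_funX; apply: measurable_funB; first exact: mind.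
    by apply: measurable_continuous01; exact: continuous_trap.
  move=> x _; have [/andP[t0 t1] _ _] := trap_bounds x l0 lb.
  have := bd b x; rewrite /ind => /andP[i0 i1].
  by rewrite ger0_norm ?sqr_ge0//; nra.
- apply: (@integrable_bounded01 _ _ 2).
    apply: measurable_funD; first by apply: measurable_funM => //; exact: measurable_cst.
    by apply: measurable_funB.
  move=> x _; have := bd (2 * l) x; have := bd b x; have := bd (b - l) x.
  by rewrite ler_norml; lra.
- move=> x _; have [/andP[t0 t1] tb tm] := trap_bounds x l0 lb.
  rewrite /ind !indicE !mem_setE !in_itv /=.
  case: (ltP x b) tb => [xb _|xb /(_ isT) ->].
    case: (ltP x (b - l)) tm => [xl|xl _].
      case: (ltP x (2 * l)) => [x2 _|x2].
        by rewrite /=; nra.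
      by rewrite (ltW xl) => /(_ isT) -> /=; nra.
    by case: (ltP x (2 * l)) => _ /=; nra.
  rewrite (_ : (x < b - l) = false); last by apply/negbTE; rewrite -leNgt; lra.
  by case: (ltP x (2 * l)) => _ /=; nra.
Qed.

End Trapezoid.

(** * Weak derivatives are inverse to primitives; density of H^1_0(0,1) *)

Section WeakDerivative.
Variable R : realType.
Local Notation mu := (@lebesgue_measure R).
Local Notation I := (I01 R).
Local Notation Re := (@complex.Re R).
Local Notation Im := (@complex.Im R).
Implicit Types (f g h u v w : L2 R) (x y a b l : R).

Lemma cint01_mul_real (h : R -> R) u : sq_int (fun x => (h x)%:C) ->
  cint01 (fun x => u x * (h x)%:C) = inner (rcls h) u.
Proof.
move=> hh; rewrite inner_clsl//; congr cint01; apply/funext => x.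
by rewrite mulrC; congr (_ * _); apply: complex_ext => /=; rewrite ?oppr0.
Qed.

Lemma test_fun_continuous (phi : R -> R) : test_fun phi -> continuous phi.
Proof.
by case=> dphi _ _ x; apply: differentiable_continuous; apply/derivable1_diffP.
Qed.

Lemma weak_derivE u g : weak_deriv u g <->
  forall phi : R -> R, test_fun phi ->
    inner (rcls (derive1 phi)) u = - inner (rcls phi) g.
Proof.
split=> h phi tphi; have [_ c1 _] := tphi; have := h phi tphi;
  rewrite !cint01_mul_real//; apply: sq_int_continuous => //; exact: test_fun_continuous.
Qed.

Lemma V_derive1 (phi : R -> R) : test_fun phi ->
  V (rcls (derive1 phi)) = rcls phi /\ inner (one R) (rcls (derive1 phi)) = 0.
Proof.
move=> tphi; have cphi := test_fun_continuous tphi.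
have [dphi c1 [a [b [a0 b1 sup]]]] := tphi.
have z0 : phi 0 = 0 by apply: sup; rewrite negb_and -!ltNge a0.
have z1 : phi 1 = 0 by apply: sup; rewrite negb_and -!ltNge b1 orbT.
split; last first.
  rewrite -(chi1 (lexx 1)) -/(ev _ _) ev_FTC//; last by rewrite ler01 lexx.
  by rewrite z0 z1 subrr.
apply: cls_eq; first exact: sq_int_continuous.
apply: ae01_trans (clsE (sq_int_ev _)) _.
apply/(@filterE _ _ (ae01_filter R)) => x; rewrite /I01 /= in_itv /= => /andP[x0 x1].
by rewrite ev_FTC ?z0 ?subr0// !ltW.
Qed.

(** A test function vanishes at both ends, so it is the primitive of its derivative, and that
    derivative is orthogonal to 1. This removes the boundary term of [integration_by_parts] and the
    constant c. *)
Lemma weak_deriv_V (c : R[i]) g : weak_deriv (c *: one R + V g) g.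
Proof.
apply/weak_derivE => phi /V_derive1 [Vphi o].
have := integration_by_parts (rcls (derive1 phi)) g.
rewrite Vphi o rmorph0 mul0r innerDr innerZr (inner_conj _ (one R)) o rmorph0.
by rewrite mulr0 add0r => /eqP; rewrite addrC addr_eq0 => /eqP.
Qed.

Lemma weak_deriv_linear (c : R[i]) u g v h :
  weak_deriv u g -> weak_deriv v h -> weak_deriv (c *: u + v) (c *: g + h).
Proof.
move=> /weak_derivE ug /weak_derivE vh; apply/weak_derivE => phi tphi.
by rewrite !innerDr !innerZr ug// vh// mulrN opprD.
Qed.

(** The primitive of a trapezoid stays at b - 2 l beyond b. The reference primitive with parameters
    1/2 and 1/8 ends at 1/4, so 4 (b - 2 l) times it restores compact support. *)
Lemma test_fun_trap b l : 0 < b < 1 -> 0 < l -> 3 * l <= b ->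
  test_fun (fun x => trap_prim b l x - 4 * (b - 2 * l) * trap_prim (1/2) (1/8) x).
Proof.
move=> /andP[b0 b1] l0 lb.
have is_d x : is_derive x 1
    (fun x => trap_prim b l x - 4 * (b - 2 * l) * trap_prim (1/2) (1/8) x)
    (trap b l x - 4 * (b - 2 * l) * trap (1/2) (1/8) x).
  exact: (is_deriveB (is_derive_trap b l x)
    (is_deriveZ (4 * (b - 2 * l)) (is_derive_trap (1/2) (1/8) x))).
split.
- by move=> x; have [] := is_d x.
- rewrite (_ : derive1 _ = fun x => trap b l x - 4 * (b - 2 * l) * trap (1/2) (1/8) x).
    move=> x; apply: cvgB; first exact: continuous_trap.
    by apply: cvgM; [exact: cvg_cst|exact: continuous_trap].
  by apply/funext => x; rewrite derive1E; have [_ ->] := is_d x.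
- exists (Num.min l (1/8)), (Num.max b (1/2)); split.
  + by rewrite lt_min l0; lra.
  + by rewrite gt_max b1; lra.
  + move=> x; rewrite negb_and -!ltNge => /orP[|].
      rewrite lt_min => /andP[xl x8].
      by rewrite !trap_prim_le ?mulr0 ?subrr//; lra.
    rewrite gt_max => /andP[bx x2].
    by rewrite !trap_prim_ge//; lra.
Qed.

Lemma derive1_test_trap b l :
  derive1 (fun x => trap_prim b l x - 4 * (b - 2 * l) * trap_prim (1/2) (1/8) x) =
  (fun x => trap b l x - 4 * (b - 2 * l) * trap (1/2) (1/8) x).
Proof.
apply/funext => x; rewrite derive1E.
by have [_ ->] := is_deriveB (is_derive_trap b l x)
    (is_deriveZ (4 * (b - 2 * l)) (is_derive_trap (1/2) (1/8) x)).
Qed.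

(* The trapezoids approximate the indicators of the intervals (0,b). *)
Lemma trap_vanish w :
  (forall b l, 0 < b < 1 -> 0 < l -> 3 * l <= b -> inner (rcls (trap b l)) w = 0) ->
  w = 0.
Proof.
move=> h; apply/eqP; rewrite -(inj_eq (@oppr_inj _)) oppr0; apply/eqP/inner_eq0 => f.
rewrite innerNl inner_conj -[RHS]oppr0; congr (- _).
rewrite -[RHS](rmorph0 Num.conj); congr (Num.conj _).
apply: (antilinear_vanish (phi := fun f => inner f w)) => //.
- by move=> c u v; rewrite innerDl innerZl.
- exact: bounded_form_inner.
move=> b b01; have /andP[b0 b1] := b01.
have key l : 0 < l -> 3 * l <= b ->
    Re (inner (chi b) w) ^+ 2 + Im (inner (chi b) w) ^+ 2 <= 3 * l * N2 w.
  move=> l0 lb; have <- : inner (chi b - rcls (trap b l)) w = inner (chi b) w.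
    by rewrite innerBl h// subr0.
  by apply: inner_le_l; apply: N2_chi_trap => //; exact: ltW.
have z : Re (inner (chi b) w) ^+ 2 + Im (inner (chi b) w) ^+ 2 <= 0.
  rewrite leNgt; apply/negP => s0.
  set s := (X in 0 < X) in s0 key.
  have nw := N2_ge0 w.
  have d0 : 0 < 6 * (N2 w + 1) by lra.
  (* The first bound makes the trapezoid admissible; the second makes 3 l (N2 w + 1) at most s/2,
     which contradicts [key]. *)
  have := key (Num.min (b / 3) (s / (6 * (N2 w + 1)))) _ _.
  have hm : Num.min (b / 3) (s / (6 * (N2 w + 1))) * (6 * (N2 w + 1)) <= s.
    by rewrite -ler_pdivlMr// ge_min lexx orbT.
  have hb : 3 * Num.min (b / 3) (s / (6 * (N2 w + 1))) <= b.
    have : Num.min (b / 3) (s / (6 * (N2 w + 1))) <= b / 3 by rewrite ge_min lexx.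
    by lra.
  have hp : 0 < Num.min (b / 3) (s / (6 * (N2 w + 1))).
    by rewrite lt_min !divr_gt0.
  move=> /(_ hp hb); move: hm hp; set m := Num.min _ _ => hm hp.
  by rewrite -/s => k; have := mulr_ge0 (ltW hp) nw; lra.
move: z; move: (inner _ _) => z hz.
have r0 := sqr_ge0 (Re z); have i0 := sqr_ge0 (Im z).
by apply: complex_ext; apply/eqP; rewrite -sqrf_eq0; apply/eqP => /=; lra.
Qed.

(** The lemma of du Bois-Reymond. The constant is the mean of u weighted by the reference trapezoid,
    of integral 1/4. Testing with the functions of [test_fun_trap] then says that u - c is
    orthogonal to every trapezoid. *)
Lemma weak_deriv0 u : weak_deriv u 0 -> exists c : R[i], u = c *: one R.
Proof.
move=> /weak_derivE hu; exists (4 * inner (rcls (trap (1/2) (1/8))) u).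
set c := 4 * _; apply/eqP; rewrite -subr_eq0; apply/eqP.
apply: trap_vanish => b l b01 l0 lb.
have tb := test_fun_trap b01 l0 lb; have := hu _ tb.
rewrite derive1_test_trap inner0r oppr0.
rewrite (_ : (fun x => _ - _) = fun x => - (4 * (b - 2 * l)) * trap (1/2) (1/8) x + trap b l x); last first.
  by apply/funext => x; rewrite mulNr addrC.
rewrite rclsZD; [|exact: sq_int_trap|exact: sq_int_trap].
rewrite innerDl innerZl => h0.
have -> : inner (rcls (trap b l)) (u - c *: one R) =
    inner (rcls (trap b l)) u - c * inner (rcls (trap b l)) (one R).
  by rewrite innerBr innerZr.
have -> : inner (rcls (trap b l)) (one R) = (b - 2 * l)%:C.
  rewrite inner_conj -(chi1 (lexx 1)) -/(ev _ _) -derive1_trap ev_FTC.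
  - case/andP: b01 => b0 b1.
    rewrite trap_prim_ge ?(ltW b1)// trap_prim_le ?(ltW l0)// subr0.
    by apply: complex_ext; rewrite ?reimE /= ?oppr0.
  - exact: derivable_trap.
  - by rewrite derive1_trap; exact: continuous_trap.
  - by rewrite ler01 lexx.
rewrite -[RHS]h0 addrC /c; congr (_ + _).
move: (inner _ u) => z.
by apply: complex_ext; rewrite ?reimE /=; ring.
Qed.

Lemma weak_derivP u g : weak_deriv u g <-> exists c : R[i], u = c *: one R + V g.
Proof.
split=> [h|[c ->]]; last exact: weak_deriv_V.
have := weak_deriv_linear (-1) (weak_deriv_V 0 g) h.
rewrite !scaleN1r (addNr g) => /weak_deriv0 [c].
rewrite scale0r add0r => /eqP; rewrite addrC subr_eq => /eqP ->.
by exists c.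
Qed.

(** The space H^1_0(0,1): a primitive starting at 0 also ends at 0 exactly when the integrand has
    mean 0. *)
Definition H10 : set (L2 R) := [set u | exists2 h, inner (one R) h = 0 & u = V h].

(** The closure of [H10] is a closed subspace, and it contains every [chi b] with 0 < b < 1 because
    trapezoids lie in [H10]. *)
Lemma H10_dense u (e : R) : 0 < e -> exists2 v, H10 v & N2 (u - v) < e.
Proof.
move=> e0.
pose L := [set u | forall e : R, 0 < e -> exists2 v, H10 v & N2 (u - v) < e].
suff : L u by apply.
apply: closed_subspace_full.
- split.
    move=> r r0; exists 0; last by rewrite subr0 /N2 inner0r.
    by exists 0; rewrite ?inner0r// V0.
  move=> c f g Lf Lg r r0.
  set C := complex.Re c ^+ 2 + complex.Im c ^+ 2.
  have C0 : 0 <= C by rewrite addr_ge0 ?sqr_ge0.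
  have [|f' [hf orf Ef] nf] := Lf (r / (4 * (C + 1))).
    by rewrite divr_gt0// mulr_gt0// ltr_wpDl.
  have [|g' [hg org Eg] ng] := Lg (r / 4); first by rewrite divr_gt0.
  exists (c *: f' + g').
    exists (c *: hf + hg); first by rewrite innerDr innerZr orf org mulr0 addr0.
    by rewrite V_linear Ef Eg.
  rewrite opprD addrACA -scalerBr; apply: le_lt_trans (N2_leD _ _) _.
  rewrite N2Z -/C.
  move: nf ng; rewrite ltr_pdivlMr ?mulr_gt0 ?ltr_wpDl//.
  have := N2_ge0 (f - f'); move: (N2 (f - f')) (N2 (g - g')) => p q p0 h1 h2.
  by nra.
- move=> f Lf r r0; have [|g Lg fg] := Lf (r / 4); first by rewrite divr_gt0.
  have [|v Hv gv] := Lg (r / 4); first by rewrite divr_gt0.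
  exists v => //; rewrite -(subrK g f) -addrA.
  by apply: le_lt_trans (N2_leD _ _) _; lra.
- move=> b /andP[b0 b1] r r0.
  pose l := Num.min (b / 3) (r / 6).
  have l0 : 0 < l by rewrite lt_min !divr_gt0.
  have lb : l <= b / 3 by rewrite ge_min lexx.
  have lr : l <= r / 6 by rewrite ge_min lexx orbT.
  exists (rcls (trap b l)).
    exists (trap_step b l); first by apply: trap_step_orth; lra.
    by rewrite V_trap_step//; lra.
  by apply: le_lt_trans (N2_chi_trap _ _ _) _; lra.
Qed.

End WeakDerivative.

(** * Boundary values and Green's formula *)

Section Values.
Variable R : realType.
Local Notation mu := (@lebesgue_measure R).
Local Notation I := (I01 R).
Local Notation Re := (@complex.Re R).
Local Notation Im := (@complex.Im R).
Implicit Types (f g h u v w : L2 R) (a b c d : R[i]) (x y t : R).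

Lemma continuous_ae0 (k : R -> R) : {within `[0, 1], continuous k} ->
    {ae mu, forall x, I x -> k x = 0} ->
  forall t, 0 <= t <= 1 -> k t = 0.
Proof.
move=> /subspace_continuousP ck [N [mN N0 subN]] t /[dup] t01 /andP[t0 t1].
apply/eqP; apply: contraT => kt.
have nb : nbhs t [set s | `[0, 1]%classic s -> `|k t - k s| < `|k t|].
  by have /cvgrPdist_lt := ck t t01; apply; rewrite normr_gt0.
move/nbhs_ballP: nb => [d /= d0 hd].
(* Cutting the neighbourhood off at 0 and 1 also treats t = 0 and t = 1: an interval of positive
   length, on which k is nonzero, remains inside (0,1). *)
pose lo := Num.max 0 (t - d); pose hi := Num.min 1 (t + d).
have lohi : lo < hi by rewrite gt_max !lt_min; lra.
have sub : `]lo, hi[ `<=` N.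
  move=> s /=; rewrite in_itv /= gt_max lt_min => /andP[/andP[s0 sd] /andP[s1 sd']].
  apply: subN => /= ks; have := hd s.
  rewrite /ball /= ks ?subr0 ?ltxx; last by rewrite /I01 /= in_itv /= s0.
  have -> : `|t - s| < d by rewrite ltr_norml; lra.
  by rewrite in_itv /= !ltW// => /(_ isT isT).
have : (mu `]lo, hi[ <= mu N)%E.
  by apply: le_measure => //; rewrite inE//; exact: measurable_itv.
rewrite N0 lebesgue_measure_itv /= lte_fin lohi -EFinB lee_fin.
by rewrite subr_le0 leNgt lohi.
Qed.

Lemma cont_rep_unique u (p q : R -> R[i]) : cont_rep u p -> cont_rep u q ->
  forall t, 0 <= t <= 1 -> p t = q t.
Proof.
move=> [pr pi up] [qr qi uq] t t01.
have pq : ae01 p q := ae01_trans (ae01_sym up) uq.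
apply: complex_ext; apply/eqP; rewrite -subr_eq0; apply/eqP.
- apply: (continuous_ae0 (k := fun x => Re (p x) - Re (q x))) => //.
    by move=> x; apply: continuousB; [exact: pr|exact: qr].
  by apply: (@filterS _ _ (ae01_filter R) _ _ _ pq) => x + Ix => ->; rewrite ?subrr.
- apply: (continuous_ae0 (k := fun x => Im (p x) - Im (q x))) => //.
    by move=> x; apply: continuousB; [exact: pi|exact: qi].
  by apply: (@filterS _ _ (ae01_filter R) _ _ _ pq) => x + Ix => ->; rewrite ?subrr.
Qed.

(** [value] selects some continuous representative; all of them agree on [0,1], so exhibiting one
    determines it. *)
Lemma valueE c g t : 0 <= t <= 1 -> value (c *: one R + V g) t = c + ev g t.
Proof.
move=> t01; have rep : cont_rep (c *: one R + V g) (fun t => c + ev g t).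
  split.
  - apply: continuous_subspaceT => x; under [X in continuous_at _ X]eq_fun do rewrite ReD.
    by apply: cvgD; [exact: cvg_cst|exact: continuous_Re_ev].
  - apply: continuous_subspaceT => x; under [X in continuous_at _ X]eq_fun do rewrite ImD.
    by apply: cvgD; [exact: cvg_cst|exact: continuous_Im_ev].
  - apply: ae01_trans (L2_addE _ _) _; apply: ae01D; last exact/clsE/sq_int_ev.
    apply: ae01_trans (L2_scaleE _ _) _.
    apply: (@filterS _ _ (ae01_filter R) _ _ _ (clsE (sq_int_cst (1 : R[i])))).
    by move=> x h Ix; rewrite h// mulr1.
rewrite /value; case: xgetP => [p _ hp|/(_ _ rep)//].
exact: (cont_rep_unique hp rep).
Qed.

Lemma ev0 g : ev g 0 = 0.
Proof. by rewrite /ev chi0// inner0l. Qed.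

Lemma ev1 g : ev g 1 = inner (one R) g.
Proof. by rewrite /ev chi1. Qed.

Lemma value0 c g : value (c *: one R + V g) 0 = c.
Proof.
have h : 0 <= (0 : R) <= 1 by lra.
by rewrite (valueE _ _ h) ev0 addr0.
Qed.

Lemma value1 c g : value (c *: one R + V g) 1 = c + inner (one R) g.
Proof.
have h : 0 <= (1 : R) <= 1 by lra.
by rewrite (valueE _ _ h) ev1.
Qed.

Lemma inner_full u : (forall x, 0 < x < 1 -> inner (chi x) u = 0) -> u = 0.
Proof.
move=> h; have : inner u u = 0.
  apply: (antilinear_vanish (phi := fun f => inner f u)) => //.
  - by move=> c f g; rewrite innerDl innerZl.
  - exact: bounded_form_inner.
by move=> uu; apply: N2_eq0; rewrite /N2 uu.
Qed.

(** The value at 0 gives the constant; the other values then show that g - h is orthogonal to every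
    indicator. *)
Lemma oneV_inj c d g h : c *: one R + V g = d *: one R + V h -> c = d /\ g = h.
Proof.
move=> e; have cd : c = d by rewrite -(value0 c g) e value0.
split=> //; apply/eqP; rewrite -subr_eq0; apply/eqP/inner_full => x /andP[x0 x1].
rewrite innerBr -!/(ev _ x); apply/eqP; rewrite subr_eq0; apply/eqP.
apply: (addrI c); rewrite {2}cd -!valueE ?e// !ltW//.
Qed.

Lemma DE c g : D (c *: one R + V g) = g.
Proof.
rewrite /D; case: xgetP => [h _ /weak_derivP[d]|/(_ g)].
  by move/oneV_inj => [_ ->].
by move=> h; exfalso; apply: h; exact: weak_deriv_V.
Qed.

Lemma H1P u : H1 R u <-> exists c g, u = c *: one R + V g.
Proof.
split=> [[g /weak_derivP[c ->]]|[c [g ->]]]; first by exists c, g.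
by exists g; exact: weak_deriv_V.
Qed.

Lemma oneV_lin a c d g h : a *: (c *: one R + V g) + (d *: one R + V h) =
  (a * c + d) *: one R + V (a *: g + h).
Proof. by rewrite V_linear scalerDr scalerA scalerDl addrACA. Qed.

Lemma H1_lin a u v : H1 R u -> H1 R v -> H1 R (a *: u + v).
Proof.
move=> /H1P[c [g ->]] /H1P[d [h ->]]; apply/H1P.
by rewrite oneV_lin; do 2! eexists.
Qed.

Lemma D_lin a u v : H1 R u -> H1 R v -> D (a *: u + v) = a *: D u + D v.
Proof. by move=> /H1P[c [g ->]] /H1P[d [h ->]]; rewrite oneV_lin !DE. Qed.

Lemma value0_lin a u v : H1 R u -> H1 R v ->
  value (a *: u + v) 0 = a * value u 0 + value v 0.
Proof. by move=> /H1P[c [g ->]] /H1P[d [h ->]]; rewrite oneV_lin !value0. Qed.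

Lemma value1_lin a u v : H1 R u -> H1 R v ->
  value (a *: u + v) 1 = a * value u 1 + value v 1.
Proof.
move=> /H1P[c [g ->]] /H1P[d [h ->]]; rewrite oneV_lin !value1 innerDr innerZr.
by rewrite mulrDr addrACA.
Qed.

Lemma green1 u v : H1 R u -> H1 R v ->
  inner u (D v) + inner (D u) v =
  (value u 1)^*%R * value v 1 - (value u 0)^*%R * value v 0.
Proof.
move=> /H1P[c [g ->]] /H1P[d [k ->]]; rewrite !DE !value1 !value0.
have := integration_by_parts g k.
rewrite innerDl innerDr innerZl innerZr (inner_conj g (one R)) rmorphD /=.
move: (inner (V g) k) (inner g (V k)) (inner (one R) g) (inner (one R) k).
move=> p q A B e.
transitivity ((c^*)%R * B + d * (A^*)%R + (p + q)); first by ring.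
by rewrite e; ring.
Qed.

Lemma H2P u : H2 R u <-> exists c d h, u = c *: one R + V (d *: one R + V h).
Proof.
split=> [[/H1P[c [g ->]]]|[c [d [h ->]]]].
  by rewrite DE => /H1P[d [h ->]]; exists c, d, h.
by split; [|rewrite DE]; apply/H1P; do 2! eexists.
Qed.

Lemma H2_lin a u v : H2 R u -> H2 R v -> H2 R (a *: u + v).
Proof.
by move=> [u1 u2] [v1 v2]; split; [exact: H1_lin|rewrite D_lin//; exact: H1_lin].
Qed.

Lemma H2_0 : H2 R 0.
Proof.
by apply/H2P; exists 0, 0, 0; rewrite !scale0r V0 !add0r V0.
Qed.

(* The four boundary values of u, combined so that the form x^* y' - y^* x' is
   diagonal: p = x - i y and q = x + i y with x = (u(0), u(1)) and
   y = (u'(0), - u'(1)). *)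
Definition p0 u : R[i] := value u 0 - 'i * value (D u) 0.
Definition p1 u : R[i] := value u 1 + 'i * value (D u) 1.
Definition q0 u : R[i] := value u 0 + 'i * value (D u) 0.
Definition q1 u : R[i] := value u 1 - 'i * value (D u) 1.

Lemma p0_lin a u v : H2 R u -> H2 R v -> p0 (a *: u + v) = a * p0 u + p0 v.
Proof. by move=> [u1 u2] [v1 v2]; rewrite /p0 D_lin// !value0_lin//; move: (value _ _) (value _ _) (value _ _) (value _ _) => *; ring. Qed.

Lemma p1_lin a u v : H2 R u -> H2 R v -> p1 (a *: u + v) = a * p1 u + p1 v.
Proof. by move=> [u1 u2] [v1 v2]; rewrite /p1 D_lin// !value1_lin//; move: (value _ _) (value _ _) (value _ _) (value _ _) => *; ring. Qed.

Lemma q0_lin a u v : H2 R u -> H2 R v -> q0 (a *: u + v) = a * q0 u + q0 v.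
Proof. by move=> [u1 u2] [v1 v2]; rewrite /q0 D_lin// !value0_lin//; move: (value _ _) (value _ _) (value _ _) (value _ _) => *; ring. Qed.

Lemma q1_lin a u v : H2 R u -> H2 R v -> q1 (a *: u + v) = a * q1 u + q1 v.
Proof. by move=> [u1 u2] [v1 v2]; rewrite /q1 D_lin// !value1_lin//; move: (value _ _) (value _ _) (value _ _) (value _ _) => *; ring. Qed.

Lemma i_neq0 : ('i : R[i]) != 0.
Proof. exact: neq0Ci. Qed.

Lemma addi_subi_eq0 a b : a - 'i * b = 0 -> a + 'i * b = 0 -> a = 0 /\ b = 0.
Proof.
move=> f1 f2; have a0 : a = 0.
  have : (2 : R[i]) * a = 0 by rewrite -[RHS](addr0 0) -{1}f1 -f2; ring.
  by move/eqP; rewrite mulf_eq0 pnatr_eq0 => /eqP.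
split=> //; move: f2; rewrite a0 add0r => /eqP; rewrite mulf_eq0 (negbTE i_neq0) /=.
by move/eqP.
Qed.

Lemma Smin_domP u : dom (Smin R) u <->
  [/\ H2 R u, p0 u = 0, p1 u = 0, q0 u = 0 & q1 u = 0].
Proof.
split=> [[y [/= uH [v0 v1] [d0 d1] _]]|[uH hp0 hp1 hq0 hq1]].
  by split=> //; rewrite /p0 /p1 /q0 /q1 ?v0 ?v1 ?d0 ?d1 mulr0 ?subr0 ?addr0.
have [a0 c0] := addi_subi_eq0 hp0 hq0; have [b0 d0] := addi_subi_eq0 hq1 hp1.
by exists (- D (D u)).
Qed.

(** The boundary form of Green's formula, up to the factor i/2, as an indefinite Hermitian form in
    the p- and q-data. *)
Definition bform u v : R[i] :=
  (p0 u)^*%R * p0 v + (p1 u)^*%R * p1 v - (q0 u)^*%R * q0 v - (q1 u)^*%R * q1 v.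

(** The capital letters stand for conjugates. Keeping them independent leaves a polynomial identity,
    which serves both Green's formula and the boundary matrix. *)
Lemma diagonal_form (j a b c d A B C E : R[i]) : j * j = -1 ->
  2 * (E * b - C * a - B * d + A * c) = j *
  ((A - - j * C) * (a - j * c) + (B + - j * E) * (b + j * d) -
   (A + - j * C) * (a + j * c) - (B - - j * E) * (b - j * d)).
Proof.
move=> i2.
transitivity (2 * - (j * j) * (E * b - C * a - B * d + A * c)); last by ring.
by rewrite i2 opprK mulr1.
Qed.

Lemma green u v : H2 R u -> H2 R v ->
  2 * (inner u (- D (D v)) - inner (- D (D u)) v) = 'i * bform u v.
Proof.
move=> [u1 u2] [v1 v2]; have := green1 u1 v2; have := green1 u2 v1.
rewrite innerNr innerNl.
rewrite /bform /p0 /p1 /q0 /q1.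
move: (inner (D u) (D v)) (inner (D (D u)) v) (inner u (D (D v))) => X Y Z.
move: (value u 0) (value u 1) (value (D u) 0) (value (D u) 1).
move: (value v 0) (value v 1) (value (D v) 0) (value (D v) 1).
move=> a b c d a' b' c' d' e1 e2.
rewrite !(rmorphD, rmorphB, rmorphN, rmorphM) /= conjCi.
transitivity (2 * ((X + Y) - (Z + X))); first by ring.
rewrite e1 e2.
move: (a'^*)%R (b'^*)%R (c'^*)%R (d'^*)%R => A B C E.
transitivity (2 * (E * b - C * a - B * d + A * c)); first by ring.
by apply: diagonal_form; rewrite -expr2 sqrCi.
Qed.

End Values.

(** * Density of D(S), the adjoint of S, and prescribed boundary values *)

Section MinimalOperator.
Variable R : realType.
Local Notation Re := (@complex.Re R).
Local Notation Im := (@complex.Im R).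
Implicit Types (f g h u v w : L2 R) (a b c d : R[i]) (T : set (L2 R * L2 R)).

Lemma inner_one : inner (one R) (one R) = 1.
Proof.
rewrite -(chi1 (lexx 1)) inner_chi//; by rewrite ler01 lexx.
Qed.

Lemma N2_one : N2 (one R) = 1.
Proof. by rewrite /N2 inner_one. Qed.

Lemma one_neq0 : one R <> 0.
Proof. by move=> e; have := N2_one; rewrite e /N2 inner0r => /eqP; rewrite eq_sym oner_eq0. Qed.

(** A double primitive has zero value and derivative at 0; the two hypotheses are the conditions at
    1. *)
Lemma Smin_dom_VV h : inner (one R) h = 0 -> inner (one R) (V h) = 0 ->
  Smin R (V (V h), - h).
Proof.
move=> h1 h2; have e1 : V h = 0 *: one R + V h by rewrite scale0r add0r.
have e2 : V (V h) = 0 *: one R + V (0 *: one R + V h) by rewrite -e1 scale0r add0r.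
rewrite /Smin /= e2; split.
- by apply/H2P; exists 0, 0, h.
- by rewrite value0 value1 -e1 h2 add0r.
- by rewrite DE value0 value1 h1 add0r.
- by rewrite !DE.
Qed.

(** Serves to correct means inside [H10]. An element of mean 0 has squared distance at least 1 from
    [one], so a closer one can be normalized. *)
Lemma H10_unit : exists2 k, H10 k & inner (one R) k = 1.
Proof.
have [k [h oh ->] nk] := H10_dense (one R) ltr01.
have k0 : inner (one R) (V h) != 0.
  apply/eqP => k0; move: nk; rewrite -[_ - _]/(one R + - V h) N2D N2N N2_one innerNr k0.
  by rewrite oppr0 mulr0 addr0 => nk; have := N2_ge0 (V h); lra.
exists ((inner (one R) (V h))^-1 *: V h); last by rewrite innerZr mulVf.
by exists ((inner (one R) (V h))^-1 *: h); rewrite ?VZ// innerZr oh mulr0.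
Qed.

(** f is approximated by V h with h of mean 0, and h by g in [H10]. Subtracting m k makes the mean
    of g vanish, so that V (g - m k) lies in D(S). The correction is small: since h has mean 0, m =
    - <1, h - g>. The factor 2 (1 + N2 k) collects the two errors. *)
Lemma Smin_densely_defined : densely_defined (Smin R).
Proof.
move=> f e e0; have e2 : 0 < e ^+ 2 / 4 by rewrite divr_gt0 ?exprn_gt0.
have [v [h oh ->] nv] := H10_dense f e2.
have [k [k' ok' Ek'] ok] := H10_unit.
have c0 : 0 < 2 * (1 + N2 k) by have := N2_ge0 k; lra.
have [|g [g' og' Eg'] ng] := @H10_dense R h (e ^+ 2 / 4 / (2 * (1 + N2 k))).
  by rewrite divr_gt0.
pose m := inner (one R) g.
have om : inner (one R) (g - m *: k) = 0.
  by rewrite innerBr innerZr ok mulr1 subrr.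
have Ev : g - m *: k = V (g' - m *: k').
  by rewrite VD VN VZ -Eg' -Ek'.
exists (V (g - m *: k)).
  exists (- (g' - m *: k')); rewrite Ev; apply: Smin_dom_VV.
    by rewrite innerBr innerZr og' ok' mulr0 subrr.
  by rewrite -Ev.
rewrite L2norm_lt// -(subrK (V h) f) -addrA.
apply: le_lt_trans (N2_leD _ _) _.
have : N2 (V h - V (g - m *: k)) < e ^+ 2 / 4.
  rewrite -VN -VD; apply: le_lt_trans (N2_V _) _.
  have -> : h - (g - m *: k) = (h - g) + m *: k by rewrite opprB addrA addrAC.
  apply: le_lt_trans (N2_leD _ _) _; rewrite N2Z.
  have hm : Re m ^+ 2 + Im m ^+ 2 <= N2 (h - g).
    have -> : m = - inner (one R) (h - g) by rewrite innerBr oh sub0r opprK.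
    rewrite ReN ImN !sqrrN; apply: le_trans (cauchy_schwarz _ _) _.
    by rewrite N2_one mul1r.
  move: ng; rewrite ltr_pdivlMr// => ng.
  have := ler_wpM2r (N2_ge0 k) hm; move: ng.
  move: (N2 (h - g)) (N2 k) (Re m ^+ 2 + Im m ^+ 2) => p q r ? ?; lra.
move: nv; move: (N2 (f - _)) (N2 (V h - _)) => p q ? ?; lra.
Qed.

(* The component of t |-> t orthogonal to the constants. *)
Definition affine : L2 R := V (one R) - inner (one R) (V (one R)) *: one R.

Lemma inner_one_affine : inner (one R) affine = 0.
Proof. by rewrite /affine innerBr innerZr inner_one mulr1 subrr. Qed.

Lemma affine_neq0 : inner affine affine != 0.
Proof.
apply/eqP => s0; have /eqP : affine = 0 by apply: N2_eq0; rewrite /N2 s0.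
rewrite subr_eq0 => /eqP e; apply: one_neq0.
have : 0 *: one R + V (one R) = inner (one R) (V (one R)) *: one R + V 0.
  by rewrite V0 scale0r add0r addr0.
by move/oneV_inj => [].
Qed.

Lemma inner_Vone u : inner (V (one R)) u = inner affine u +
  (inner (one R) (V (one R)))^*%R * inner (one R) u.
Proof. by rewrite /affine innerBl innerZl subrK. Qed.

Lemma inner_one_V u : inner (one R) (V u) = inner (one R) u - inner (V (one R)) u.
Proof.
have := integration_by_parts (one R) u; rewrite inner_one rmorph1 mul1r => <-.
by rewrite addrAC subrr add0r.
Qed.

(** By [inner_one_V] the conditions on h mean orthogonality to 1 and [affine]. The component w' of w
    orthogonal to both is itself such an h, so <w, w'> = 0 and hence <w', w'> = 0. *)
Lemma span_orth w : (forall h, inner (one R) h = 0 -> inner (one R) (V h) = 0 ->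
  inner w h = 0) -> exists a b, w = a *: one R + b *: V (one R).
Proof.
move=> hw.
pose a := inner (one R) w; pose b := inner affine w / inner affine affine.
pose w' := w - (a *: one R + b *: affine).
have o1 : inner (one R) w' = 0.
  by rewrite /w' innerBr innerDr !innerZr inner_one inner_one_affine mulr1 mulr0 addr0 subrr.
have so : inner affine (one R) = 0 by rewrite inner_conj inner_one_affine rmorph0.
have o2 : inner affine w' = 0.
  rewrite /w' innerBr innerDr !innerZr so mulr0 add0r /b divfK ?subrr//.
  exact: affine_neq0.
have ww : inner w w' = 0.
  by apply: hw => //; rewrite inner_one_V inner_Vone o1 o2 mulr0 addr0 subr0.
have /eqP : w' = 0.
  apply: N2_eq0; rewrite /N2 {1}/w' innerBl ww innerDl !innerZl o1 o2.
  by rewrite !mulr0 addr0 subr0.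
rewrite subr_eq0 => /eqP ->.
exists (a - b * inner (one R) (V (one R))), b.
rewrite /affine scalerBr scalerA scalerBl.
by rewrite addrA addrAC.
Qed.

Lemma green_bform0 u v : H2 R u -> H2 R v ->
  bform u v = 0 <-> inner u (- D (D v)) = inner (- D (D u)) v.
Proof.
move=> uH vH; have e := green uH vH; split=> h.
  move: e; rewrite h mulr0 => /eqP.
  by rewrite mulf_eq0 pnatr_eq0 /= subr_eq0 => /eqP.
move: e; rewrite h subrr mulr0 => /esym/eqP.
by rewrite mulf_eq0 (negbTE (i_neq0 R)) => /eqP.
Qed.

Lemma bform_Smin u v : dom (Smin R) v -> bform u v = 0.
Proof. by move=> /Smin_domP[_ a b c d]; rewrite /bform a b c d !mulr0 !subr0 addr0. Qed.

Theorem adjoint_Smin : adjoint (Smin R) = Smax R.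
Proof.
apply/seteqP; split=> [[p1 p2] adj|[p1 p2] [p1H p2E] x y Sxy]; last first.
  have [xH _ _ yE] := Sxy; rewrite p2E; have -> : y = - D (D x) by [].
  by apply/(green_bform0 p1H xH)/bform_Smin; exists y.
(* A particular solution of -k'' = p2. The difference p1 - k is orthogonal to every h of
   [span_orth], hence an affine function, which puts p1 in H^2. *)
have [k kE [kH Dk]] : exists2 k, k = V (V (- p2)) & H2 R k /\ - D (D k) = p2.
  exists (0 *: one R + V (0 *: one R + V (- p2))); first by rewrite !scale0r !add0r.
  by rewrite !DE opprK; split=> //; apply/H2P; exists 0, 0, (- p2).
have [|a [b E]] := @span_orth (p1 - k).
  move=> h h1 h2; have := Smin_dom_VV h1 h2; move: (V (V h)) => x S.
  have e2 : inner p1 (- h) = inner p2 x := adj _ _ S.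
  have [xH _ _ Sd] := S; have {}Sd : - h = - D (D x) := Sd.
  have e : inner k (- D (D x)) = inner (- D (D k)) x.
    by apply/(green_bform0 kH xH)/bform_Smin; exists (- h).
  have e3 : inner k (- h) = inner p1 (- h) := etrans (congr1 (inner k) Sd)
    (etrans e (etrans (congr1 (fun y => inner y x) Dk) (esym e2))).
  apply: oppr_inj; rewrite oppr0 -innerNr innerBl.
  exact: etrans (congr1 (fun z => inner p1 (- h) - z) e3) (subrr _).
have Ep : p1 = a *: one R + V (b *: one R + V (- p2)).
  by rewrite -(subrK k p1) E kE VD VZ addrA.
split=> /=; last by rewrite Ep !DE opprK.
by apply/H2P; exists a, b, (- p2).
Qed.

Lemma submod_closedP (E : lmodType R[i]) (A : set E) : submod_closed (mem A) <->
  A 0 /\ forall a (u v : E), A u -> A v -> A (a *: u + v).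
Proof.
split=> [[A0 h]|[A0 h]]; split.
- by have := A0; rewrite inE.
- by move=> a u v Au Av; have := h a u v; rewrite !inE; apply.
- by rewrite inE.
- by move=> a u v; rewrite !inE; exact: h.
Qed.

Lemma im_linear_bound (z : R[i]) (r : R) :
  (forall c, 0 <= r + Im (c * z)) -> z = 0.
Proof.
move=> h; have key t : (forall s : R, 0 <= r + s * t) -> t = 0 :> R.
  move=> hs; apply/eqP; apply: contraT => t0.
  (* At this s the affine function takes the value -1. *)
  by have := hs (- (r + 1) / t); rewrite divfK//; lra.
apply: complex_ext; apply: key => s /=.
- by have := h (s%:C * 'i); rewrite !reimE /=; lra.
- by have := h s%:C; rewrite !reimE /=; lra.
Qed.

Lemma Im_conjE (z : R[i]) : Im (z^*)%R = - Im z. Proof. exact: Im_conj. Qed.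

Theorem dissipative_sub_Smax T : dissipative T -> Smin R `<=` T -> T `<=` Smax R.
Proof.
move=> [[/submod_closedP[T0 Tl] _] _ Td] ST; rewrite -adjoint_Smin.
move=> [p1 p2] Tp x y Sxy /=; apply/eqP; rewrite -subr_eq0; apply/eqP.
have Txy := ST _ Sxy.
have sym : Im (inner x y) = 0.
  have : Smax R (x, y) by case: Sxy => xH _ _ yE; split.
  rewrite -adjoint_Smin => /(_ _ _ Sxy) e; have {}e : inner x y = inner y x := e.
  have := congr1 Im (etrans e (inner_conj y x)); rewrite Im_conjE.
  by move: (inner x y) => z; lra.
(* Dissipativity of T at c (x, y) + (p1, p2): the quadratic term |c|^2 <x, y> is real by [sym], and
   Im (c^* <x, p2>) = - Im (c <p2, x>). *)
have key c : 0 <= Im (inner p1 p2) + Im (c * (inner p1 y - inner p2 x)).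
  have := Td _ _ (Tl c _ _ Txy Tp).
  rewrite !innerDl !innerDr !innerZl !innerZr (inner_conj x p2).
  move: sym; move: (inner p1 p2) (inner x y) (inner p1 y) (inner p2 x) => A B C E.
  rewrite !reimE => ->; move: (Re A) (Im A) (Re B) (Re C) (Im C) (Re E) (Im E) (Re c) (Im c).
  by move=> *; lra.
exact: im_linear_bound key.
Qed.

(** For u = a + V (c + V h) the data at 1 prescribe <1, h> = x and <1, V h> = z, that is, the inner
    products of h with the orthogonal vectors 1 and [affine]; h is taken in their span. *)
Lemma H2_boundary a b c d : exists u, [/\ H2 R u, value u 0 = a,
  value u 1 = b, value (D u) 0 = c & value (D u) 1 = d].
Proof.
pose m := inner (one R) (V (one R)).
pose x := d - c; pose z := b - a - c.
pose y := (x - (m^*)%R * x - z) / inner affine affine.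
pose h := x *: one R + y *: affine.
have o1 : inner (one R) h = x.
  by rewrite /h innerDr !innerZr inner_one inner_one_affine mulr1 mulr0 addr0.
have so : inner affine (one R) = 0 by rewrite inner_conj inner_one_affine rmorph0.
have o2 : inner affine h = x - (m^*)%R * x - z.
  by rewrite /h innerDr !innerZr so mulr0 add0r /y divfK// affine_neq0.
exists (a *: one R + V (c *: one R + V h)).
rewrite !DE !value0 !value1; split=> //; first by apply/H2P; exists a, c, h.
  rewrite innerDr innerZr inner_one inner_one_V inner_Vone -/m o1 o2 /z /x.
  move: ((m^*)%R) => M; ring.
by rewrite o1 /x addrC subrK.
Qed.

Lemma H2_pq (e0 e1 : R[i]) : exists u, [/\ H2 R u, p0 u = e0, p1 u = e1,
  q0 u = 0 & q1 u = 0].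
Proof.
have [u [uH v0 v1 w0 w1]] := H2_boundary (e0 / 2) (e1 / 2) ('i * (e0 / 2)) (- 'i * (e1 / 2)).
exists u; rewrite /p0 /p1 /q0 /q1 v0 v1 w0 w1.
have i2 : ('i : R[i]) * 'i = -1 by rewrite -expr2 sqrCi.
have half e : e / 2 + e / 2 = e :> R[i] by rewrite -mulrDl -mulr2n -[e *+ 2]mulr_natr mulfK// pnatr_eq0.
split=> //.
- by rewrite mulrA i2 mulN1r opprK half.
- by rewrite mulNr mulrN mulrA i2 mulN1r opprK half.
- by rewrite mulrA i2 mulN1r subrr.
- by rewrite mulNr mulrN opprK mulrA i2 mulN1r subrr.
Qed.

End MinimalOperator.

(** * Dissipativity in terms of p and q, and linear algebra in C^2 *)

Section BoundarySpaces.
Variable R : realType.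
Local Notation Re := (@complex.Re R).
Local Notation Im := (@complex.Im R).
Implicit Types (f g h u v w : L2 R) (a b c d : R[i]) (W : set (L2 R)) (T : set (L2 R * L2 R)).

Definition nsq (z : R[i]) : R := Re z ^+ 2 + Im z ^+ 2.

Lemma nsq_ge0 z : 0 <= nsq z.
Proof. by rewrite addr_ge0 ?sqr_ge0. Qed.

Lemma nsq0 : nsq 0 = 0.
Proof. by rewrite /nsq /= expr0n addr0. Qed.

Lemma nsq_eq0 z : nsq z = 0 -> z = 0.
Proof.
move=> /eqP; rewrite paddr_eq0 ?sqr_ge0// !sqrf_eq0 => /andP[/eqP a0 /eqP b0].
exact: complex_ext.
Qed.

Lemma conj_mul z : (z^*)%R * z = (nsq z)%:C.
Proof. by apply: complex_ext; rewrite !reimE /= /nsq; ring. Qed.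

Definition pn u := nsq (p0 u) + nsq (p1 u).
Definition qn u := nsq (q0 u) + nsq (q1 u).

Lemma bform_self u : bform u u = (pn u - qn u)%:C.
Proof.
rewrite /bform !conj_mul /pn /qn; move: (nsq _) (nsq _) (nsq _) (nsq _) => x y z t.
by apply: complex_ext => /=; ring.
Qed.

Lemma Im_inner_Smax u : H2 R u -> 4 * Im (inner u (- D (D u))) = pn u - qn u.
Proof.
move=> uH; have := green uH uH; rewrite bform_self (inner_conj (- D (D u))).
move: (inner _ _) (pn u - qn u) => z r e.
by have := congr1 Im e; rewrite !reimE /=; lra.
Qed.

Lemma Smax_lin c u v : H2 R u -> H2 R v ->
  - D (D (c *: u + v)) = c *: (- D (D u)) + (- D (D v)).
Proof.
by move=> [u1 u2] [v1 v2]; rewrite !D_lin// opprD scalerN.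
Qed.

Lemma Smax_intro u : H2 R u -> Smax R (u, - D (D u)).
Proof. by []. Qed.

Lemma SmaxE (s : L2 R * L2 R) : Smax R s -> H2 R s.1 /\ s = (s.1, - D (D s.1)).
Proof. by case: s => s1 s2 [sH /= ->]. Qed.

Lemma Smax_submod : Smax R 0 /\
  forall c (s t : L2 R * L2 R), Smax R s -> Smax R t -> Smax R (c *: s + t).
Proof.
split.
  split; first exact: H2_0.
  have [H10 _] := @H2_0 R; have D0 : D 0 = 0 :> L2 R.
    by have := D_lin (-1) H10 H10; rewrite scaler0 addr0 scaleN1r addNr.
  by rewrite /= !D0 oppr0.
move=> c s t /SmaxE[sH ->] /SmaxE[tH ->].
have -> : c *: (s.1, - D (D s.1)) + (t.1, - D (D t.1)) =
    (c *: s.1 + t.1, c *: (- D (D s.1)) + (- D (D t.1))) by [].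
exact: (eq_ind _ (fun y => Smax R (c *: s.1 + t.1, y))
  (Smax_intro (H2_lin c sH tH)) _ (Smax_lin c sH tH)).
Qed.

Lemma Smax_fun T : T `<=` Smax R -> submod_closed (mem T) -> linear_operator T.
Proof.
move=> TS Tl; split=> // y /TS [_ /= ->].
have [[_ /= e] _] := Smax_submod; exact/esym.
Qed.

Lemma densely_defined_sub T T' : T `<=` T' -> densely_defined T -> densely_defined T'.
Proof. by move=> TT dT f e /(dT f)[x [y Txy] fx]; exists x => //; exists y; exact: TT. Qed.

Lemma dissipativeP T : T `<=` Smax R -> Smin R `<=` T -> submod_closed (mem T) ->
  dissipative T <-> forall u, dom T u -> qn u <= pn u.
Proof.
move=> TS ST Tl; split=> [[_ _ h] u [y Ty]|h].
  have [uH yE] := TS _ Ty; have := h _ _ Ty; have := Im_inner_Smax uH.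
  by rewrite /= in yE; rewrite yE => e; rewrite -(pmulr_rge0 _ (ltr0n R 4)) e subr_ge0.
split; first exact: Smax_fun.
  exact: densely_defined_sub ST (@Smin_densely_defined R).
move=> u y Ty; have [uH yE] := TS _ Ty; have := Im_inner_Smax uH.
rewrite /= in yE; rewrite yE -(pmulr_rge0 _ (ltr0n R 4)) => ->; rewrite subr_ge0.
by apply: h; exists y.
Qed.

Lemma Smin_sub_Smax : Smin R `<=` Smax R.
Proof. by move=> s [sH _ _ sE]; split. Qed.

Definition H2_linear (F : L2 R -> R[i]) : Prop :=
  forall c u v, H2 R u -> H2 R v -> F (c *: u + v) = c * F u + F v.

Lemma H2_linear0 F : H2_linear F -> F 0 = 0.
Proof.
by move=> L; have := L (-1) _ _ (@H2_0 R) (@H2_0 R); rewrite scaler0 addr0 mulN1r addNr.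
Qed.

Lemma Smin_dom0 : dom (Smin R) 0.
Proof.
apply: (Smin_domP 0).2; apply: (And5 (@H2_0 R));
  apply: H2_linear0; [exact: p0_lin|exact: p1_lin|exact: q0_lin|exact: q1_lin].
Qed.

Lemma dom_Smin_pq f w : H2 R w -> dom (Smin R) f ->
  [/\ p0 (f + w) = p0 w, p1 (f + w) = p1 w, q0 (f + w) = q0 w & q1 (f + w) = q1 w].
Proof.
move=> wH /Smin_domP[fH a b c d].
have h F : H2_linear F -> F f = 0 -> F (f + w) = F w.
  by move=> lin F0; have := lin 1 _ _ fH wH; rewrite scale1r F0 mul1r add0r.
by split; apply: h => //; [exact: p0_lin|exact: p1_lin|exact: q0_lin|exact: q1_lin].
Qed.

Lemma pq_sub_Smin f w : H2 R f -> H2 R w -> p0 f = p0 w -> p1 f = p1 w ->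
  q0 f = q0 w -> q1 f = q1 w -> dom (Smin R) (f - w).
Proof.
move=> fH wH a b c d.
have h F : H2_linear F -> F f = F w -> F (f - w) = 0.
  move=> lin e; have := lin (-1) _ _ wH fH.
  by rewrite scaleN1r e mulN1r addNr addrC.
apply/Smin_domP; split.
- by rewrite addrC -scaleN1r; exact: H2_lin.
- by apply: h a; exact: p0_lin.
- by apply: h b; exact: p1_lin.
- by apply: h c; exact: q0_lin.
- by apply: h d; exact: q1_lin.
Qed.

Lemma C2_orth (P : R[i] -> R[i] -> Prop) :
    P 0 0 -> (forall c a b a' b', P a b -> P a' b' -> P (c * a + a') (c * b + b')) ->
    (exists a b, ~ P a b) ->
  exists e0 e1, 0 < nsq e0 + nsq e1 /\
    forall a b, P a b -> (e0^*)%R * a + (e1^*)%R * b = 0.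
Proof.
move=> P0 Pl [x [y nP]].
have pos a b : (a != 0) || (b != 0) -> 0 < nsq a + nsq b.
  move=> ab; rewrite lt_def addr_ge0 ?nsq_ge0// andbT.
  apply: contraTneq ab => /eqP; rewrite paddr_eq0 ?nsq_ge0// => /andP[/eqP a0 /eqP b0].
  by rewrite (nsq_eq0 a0) (nsq_eq0 b0) eqxx.
have [[a [b [Pab ab]]]|none] :=
    pselect (exists a b, P a b /\ (a != 0) || (b != 0)); last first.
  exists 1, 0; split; first by apply: pos; rewrite oner_eq0.
  move=> a b Pab; have -> : a = 0.
    by apply/eqP; apply: contra_notT none => a0; exists a, b; rewrite a0.
  by rewrite rmorph0 mulr0 mul0r addr0.
exists (- (b^*)%R), (a^*)%R; split.
  apply: pos; rewrite oppr_eq0 !conjC_eq0 orbC //.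
move=> c d Pcd; rewrite rmorphN /= !conjCK; apply/eqP; apply: contra_notT nP => ne.
pose k := a * d - b * c.
have k0 : k != 0 by move: ne; rewrite /k mulNr addrC.
have Z (s t r : R[i]) : P s t -> P (r * s) (r * t).
  by move=> Pst; rewrite -[r * s]addr0 -[r * t]addr0; exact: Pl.
have := Pl ((x * d - y * c) / k) _ _ _ _ Pab (Z _ _ ((a * y - b * x) / k) Pcd).
have -> : (x * d - y * c) / k * a + (a * y - b * x) / k * c = x.
  by rewrite /k; field; exact: k0.
by have -> : (x * d - y * c) / k * b + (a * y - b * x) / k * d = y
  by rewrite /k; field; exact: k0.
Qed.

Lemma H2_linear_comb F u v : H2 R u -> H2 R v -> H2_linear F ->
  forall c d, F (c *: u + d *: v) = c * F u + d * F v.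
Proof.
move=> uH vH lin c d; have H0 := @H2_0 R.
have F0 := H2_linear0 lin.
have e := lin d _ _ vH H0; have := lin c _ _ uH (H2_lin d vH H0).
by rewrite e F0 !addr0.
Qed.

(** An injective linear map between two-dimensional spaces is onto. Cramer's rule applies when the
    determinant k is nonzero; if k = 0, the rows yield kernel vectors, which forces all four entries
    to vanish, and then u itself is in the kernel. *)
Lemma H2_surj W (F0 F1 : L2 R -> R[i]) :
    W `<=` H2 R -> (exists u v, basis2 W u v) ->
    H2_linear F0 -> H2_linear F1 ->
    (forall w, W w -> F0 w = 0 -> F1 w = 0 -> w = 0) ->
  forall a b, exists2 w, W w & F0 w = a /\ F1 w = b.
Proof.
move=> WH [u [v [free WE]]] L0 L1 inj a b.
have Wc c d : W (c *: u + d *: v) by rewrite WE; exists c, d.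
have uH : H2 R u by apply: WH; have := Wc 1 0; rewrite scale1r scale0r addr0.
have vH : H2 R v by apply: WH; have := Wc 0 1; rewrite scale1r scale0r add0r.
have [Fc0 Fc1] := (H2_linear_comb uH vH L0, H2_linear_comb uH vH L1).
pose k := F0 u * F1 v - F0 v * F1 u.
have [k0|k0] := eqVneq k 0; last first.
  exists ((a * F1 v - b * F0 v) / k *: u + (b * F0 u - a * F1 u) / k *: v) => //.
  rewrite Fc0 Fc1; split.
    transitivity (a * (k / k)); last by rewrite divff// mulr1.
    by rewrite /k; ring.
  transitivity (b * (k / k)); last by rewrite divff// mulr1.
  by rewrite /k; ring.
have [|v0 u0] := free (F0 v) (- F0 u).
  apply: inj; first exact: Wc.
    by rewrite Fc0; ring.
  by rewrite Fc1 -[RHS]oppr0 -k0 /k; ring.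
have [|v1 u1] := free (F1 v) (- F1 u).
  apply: inj; first exact: Wc.
    by rewrite Fc0 -k0 /k; ring.
  by rewrite Fc1; ring.
have [|/eqP] := free 1 0; last by rewrite oner_eq0.
apply: inj; first exact: Wc.
  by rewrite Fc0 -[F0 u]opprK u0 v0; ring.
by rewrite Fc1 -[F1 u]opprK u1 v1; ring.
Qed.

End BoundarySpaces.

(** * The boundary matrix as a Gram matrix *)

Section BoundaryMatrix.
Variable R : realType.
Local Notation Re := (@complex.Re R).
Local Notation Im := (@complex.Im R).
Implicit Types (f g h u v w : L2 R) (a b c d : R[i]) (W : set (L2 R)) (T : set (L2 R * L2 R)).

(** The factor 1/4 is the product of 1/(2i) from [ImM] and i/2 from [diagonal_form]. *)
Lemma boundary_mxE u v (i j : 'I_2) : boundary_mx u v i j =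
  4^-1 * bform (if i == 0 then u else v) (if j == 0 then u else v).
Proof.
have key a b c d a' b' c' d' : (2 * 'i)^-1 *
    ((a^*)%R * c' + (b^*)%R * - d' - ((a'^*)%R * c + (b'^*)%R * - d)^*%R) =
   4^-1 * (((a - 'i * c)^*)%R * (a' - 'i * c') + ((b + 'i * d)^*)%R * (b' + 'i * d')
    - ((a + 'i * c)^*)%R * (a' + 'i * c') - ((b - 'i * d)^*)%R * (b' - 'i * d')).
  rewrite !(rmorphD, rmorphB, rmorphN, rmorphM) /= !conjCK conjCi.
  move: (a^*)%R (b^*)%R (c^*)%R (d^*)%R => A B C E.
  have j2 : ('i : R[i]) * 'i = -1 by rewrite -expr2 sqrCi.
  have n2 : (2 : R[i]) != 0 by rewrite pnatr_eq0.
  have e := diagonal_form a' b' c' d' A B C E j2.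
  apply: (mulfI (_ : 2 * 'i != 0)); first by rewrite mulf_neq0// i_neq0.
  rewrite mulrA mulfV ?mul1r ?mulf_neq0 ?i_neq0//.
  set s := (X in _ = _ * (_ * X)).
  have -> : 2 * 'i * (4^-1 * s) = 2^-1 * ('i * s) :> R[i].
    have -> : (4 : R[i]) = 2 * 2 by rewrite -natrM.
    by field.
  by rewrite /s -e mulrA mulVf// mul1r; ring.
rewrite /boundary_mx /ImM /mx2 !mxE !big_ord_recl !big_ord0 !mxE /= !addr0.
rewrite /bform /p0 /p1 /q0 /q1.
by case: (i == 0); case: (j == 0); exact: key.
Qed.

Lemma bform_conj u v : (bform u v)^*%R = bform v u.
Proof.
have key a b c d a' b' c' d' :
    ((a^*)%R * a' + (b^*)%R * b' - (c^*)%R * c' - (d^*)%R * d')^*%R =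
    (a'^*)%R * a + (b'^*)%R * b - (c'^*)%R * c - (d'^*)%R * d :> R[i].
  by rewrite !(rmorphD, rmorphB, rmorphN, rmorphM) /= !conjCK; ring.
exact: key.
Qed.

Lemma bform_linear_r u : H2_linear (bform u).
Proof.
move=> c v w vH wH; rewrite /bform (p0_lin c vH wH) (p1_lin c vH wH)
  (q0_lin c vH wH) (q1_lin c vH wH).
move: (p0 u) (p1 u) (q0 u) (q1 u) (p0 v) (p1 v) (q0 v) (q1 v).
by move: (p0 w) (p1 w) (q0 w) (q1 w) => *; ring.
Qed.

Lemma boundary_mx_form u v (x : 'cV[R[i]]_2) : H2 R u -> H2 R v ->
  let w := x 0 0 *: u + x 1 0 *: v in
  (map_mx Num.conj x^T *m boundary_mx u v *m x) 0 0 = 4^-1 * bform w w.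
Proof.
move=> uH vH w.
have wE z : bform z w = x 0 0 * bform z u + x 1 0 * bform z v.
  exact: H2_linear_comb uH vH (bform_linear_r z) _ _.
have wl z : bform w z = (x 0 0)^*%R * bform u z + (x 1 0)^*%R * bform v z.
  apply: etrans (esym (bform_conj z w)) _.
  apply: etrans (congr1 Num.conj (wE z)) _.
  apply: etrans (rmorphD _ _ _) _; congr (_ + _);
    by apply: etrans (rmorphM _ _ _) _; congr (_ * _); exact: bform_conj.
apply: etrans (_ : _ = 4^-1 * (x 0 0 * ((x 0 0)^*%R * bform u u + (x 1 0)^*%R * bform v u)
  + x 1 0 * ((x 0 0)^*%R * bform u v + (x 1 0)^*%R * bform v v))) _; last first.
  by congr (_ * _); apply: esym; apply: etrans (wE w) _; congr (_ * _ + _ * _); exact: wl.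
move: (boundary_mx u v) (boundary_mxE u v) => M ME.
rewrite !mxE !big_ord_recl !big_ord0 !mxE !big_ord_recl !big_ord0 !mxE !ME /=.
have -> : lift ord0 (ord0 : 'I_1) = 1 by apply/val_inj.
move: (bform u u) (bform u v) (bform v u) (bform v v) (x 0 0) (x 1 0) => *.
ring.
Qed.

End BoundaryMatrix.

(** * The operators S_W: dissipativity, maximality and selfadjointness *)

Section Extensions.
Variable R : realType.
Local Notation Re := (@complex.Re R).
Local Notation Im := (@complex.Im R).
Implicit Types (f g h u v w : L2 R) (a b c d : R[i]) (W : set (L2 R)) (T : set (L2 R * L2 R)).

Lemma basis2_mem W u v a b : basis2 W u v -> W (a *: u + b *: v).
Proof. by move=> [_ ->]; exists a, b. Qed.

Lemma basis2_H2 W u v : W `<=` H2 R -> basis2 W u v -> H2 R u /\ H2 R v.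
Proof.
move=> WH B; split; apply: WH.
  by have := basis2_mem 1 0 B; rewrite scale1r scale0r addr0.
by have := basis2_mem 0 1 B; rewrite scale1r scale0r add0r.
Qed.

(** The right-hand side does not mention the basis, which gives the passage from one basis to every
    basis; [boundary_mx_eq0P] does the same for equality. *)
Lemma psdmxP W u v : W `<=` H2 R -> basis2 W u v ->
  psdmx (boundary_mx u v) <-> forall w, W w -> qn w <= pn w.
Proof.
move=> WH B; have [uH vH] := basis2_H2 WH B.
have pos w : (0 <= 4^-1 * bform w w) = (qn w <= pn w).
  rewrite bform_self pmulr_rge0 ?invr_gt0 ?ltr0n// lecE /= eqxx /=.
  by rewrite subr_ge0.
split=> [h w|h x].
  rewrite (B.2) => -[a [b ->]]; rewrite -pos.
  have := h (\col_i (if i == 0 then a else b)).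
  by rewrite (boundary_mx_form _ uH vH) !mxE.
by rewrite (boundary_mx_form x uH vH) pos; apply: h; exact: basis2_mem.
Qed.

Lemma boundary_mx_eq0P W u v : W `<=` H2 R -> basis2 W u v ->
  boundary_mx u v = 0 <-> forall w w', W w -> W w' -> bform w w' = 0.
Proof.
move=> WH B; have [uH vH] := basis2_H2 WH B.
have i4 : (4^-1 : R[i]) != 0 by rewrite invr_eq0 pnatr_eq0.
split=> [h w w'|h].
  have E (i j : 'I_2) : bform (if i == 0 then u else v) (if j == 0 then u else v) = 0.
    have := boundary_mxE u v i j; rewrite h mxE => /esym/eqP.
    by rewrite mulf_eq0 (negbTE i4) => /eqP.
  have uu : bform u u = 0 := E 0 0; have uv : bform u v = 0 := E 0 1.
  have vu : bform v u = 0 := E 1 0; have vv : bform v v = 0 := E 1 1.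
  have r (z : L2 R) : bform z u = 0 -> bform z v = 0 ->
      forall w, W w -> bform z w = 0.
    move=> zu zv y; rewrite (B.2) => -[a [b ->]].
    apply: etrans (H2_linear_comb uH vH (bform_linear_r z) a b) _.
    by apply: etrans (congr2 (fun s t => a * s + b * t) zu zv) _; rewrite !mulr0 addr0.
  have sym (y z : L2 R) : bform y z = 0 -> bform z y = 0.
    move=> e; apply: etrans (esym (bform_conj _ _)) _.
    by apply: etrans (congr1 Num.conj e) _; exact: rmorph0.
  move=> Ww Ww'.
  have wu : bform w u = 0 := sym _ _ (r u uu uv w Ww).
  have wv : bform w v = 0 := sym _ _ (r v vu vv w Ww).
  exact: (r w wu wv w' Ww').
apply/matrixP => i j; rewrite boundary_mxE mxE; apply/eqP.
rewrite mulf_eq0 (negbTE i4) /=; apply/eqP.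
have Wu : W u by have := basis2_mem 1 0 B; rewrite scale1r scale0r addr0.
have Wv : W v by have := basis2_mem 0 1 B; rewrite scale1r scale0r add0r.
case: (i == 0); case: (j == 0).
- exact: (h u u Wu Wu).
- exact: (h u v Wu Wv).
- exact: (h v u Wv Wu).
- exact: (h v v Wv Wv).
Qed.

Lemma bform0_qn_le W w : (forall w w', W w -> W w' -> bform w w' = 0) -> W w ->
  qn w = pn w.
Proof.
move=> h Ww; have := h w w Ww Ww; rewrite bform_self => /(congr1 Re) /= /eqP.
by rewrite subr_eq0 => /eqP.
Qed.

Lemma pn0 w : p0 w = 0 -> p1 w = 0 -> pn w = 0.
Proof. by rewrite /pn => -> ->; rewrite nsq0 addr0. Qed.

Lemma qn0 w : q0 w = 0 -> q1 w = 0 -> qn w = 0.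
Proof. by rewrite /qn => -> ->; rewrite nsq0 addr0. Qed.

Lemma pn_le0 w : pn w <= 0 -> p0 w = 0 /\ p1 w = 0.
Proof.
rewrite /pn => h; have a := nsq_ge0 (p0 w); have b := nsq_ge0 (p1 w).
by split; apply: nsq_eq0; move: a b h; move: (nsq _) (nsq _) => *; lra.
Qed.

Lemma qn_le0 w : qn w <= 0 -> q0 w = 0 /\ q1 w = 0.
Proof.
rewrite /qn => h; have a := nsq_ge0 (q0 w); have b := nsq_ge0 (q1 w).
by split; apply: nsq_eq0; move: a b h; move: (nsq _) (nsq _) => *; lra.
Qed.

Lemma conj_diff_eq0 (A B C E F G a b c e : R[i]) :
    (A^*)%R * a + (B^*)%R * b - (C^*)%R * c - (E^*)%R * e = 0 ->
    (A^*)%R * a + (B^*)%R * b - (F^*)%R * c - (G^*)%R * e = 0 ->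
  ((C - F)^*)%R * c + ((E - G)^*)%R * e = 0.
Proof.
rewrite !rmorphB /=; move: (A^*)%R (B^*)%R (C^*)%R (E^*)%R (F^*)%R (G^*)%R.
move=> A' B' C' E' F' G' h1 h2; rewrite -[RHS](subrr 0) -{1}h2 -h1; ring.
Qed.

Section Admissible.
Variable W : set (L2 R).
Hypothesis aW : admissible W.

Lemma admissible_H2 : W `<=` H2 R.
Proof.
by case: aW => _ h _ _ w /h [y]; rewrite adjoint_Smin => -[].
Qed.

Lemma admissible_eq0 w : W w -> p0 w = 0 -> p1 w = 0 -> q0 w = 0 -> q1 w = 0 -> w = 0.
Proof.
move=> Ww a b c d; have [_ _ h _] := aW.
have : (W `&` dom (Smin R)) w.
  by split=> //; apply/Smin_domP; split=> //; exact: admissible_H2.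
by rewrite h.
Qed.

Lemma SWP s : SW W s <-> Smax R s /\ exists f w, [/\ dom (Smin R) f, W w & s.1 = f + w].
Proof. by rewrite /SW /= adjoint_Smin; split=> -[]. Qed.

Lemma SW_sub : SW W `<=` Smax R.
Proof. by move=> s /SWP[]. Qed.

Lemma Smin_sub_SW : Smin R `<=` SW W.
Proof.
move=> s Ss; apply/SWP; split; first exact: Smin_sub_Smax.
have [/submod_closedP[W0 _] _ _ _] := aW.
exists s.1, 0; split=> //; last by rewrite addr0.
by exists s.2; case: s Ss.
Qed.

Lemma SW_submod : submod_closed (mem (SW W)).
Proof.
apply/submod_closedP; have [/submod_closedP[W0 Wl] _ _ _] := aW.
have [S0 Sl] := Smax_submod R; split.
  by apply/SWP; split=> //; exists 0, 0; split=> //; [exact: Smin_dom0|rewrite addr0].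
move=> c s t /SWP[Ss [f [w [Sf Ww sE]]]] /SWP[St [g [x [Sg Wx tE]]]].
apply/SWP; split; first exact: Sl.
exists (c *: f + g), (c *: w + x); split; last 1 first.
- by rewrite /= sE tE scalerDr addrACA.
- move: Sf Sg => /Smin_domP[fH f1 f2 f3 f4] /Smin_domP[gH g1 g2 g3 g4].
  have lin (F : L2 R -> R[i]) : H2_linear F -> F f = 0 -> F g = 0 -> F (c *: f + g) = 0.
    by move=> L Ff Fg; have := L c _ _ fH gH; rewrite Ff Fg mulr0 addr0.
  apply/Smin_domP; split.
  + exact: H2_lin.
  + by apply: lin => //; exact: p0_lin.
  + by apply: lin => //; exact: p1_lin.
  + by apply: lin => //; exact: q0_lin.
  + by apply: lin => //; exact: q1_lin.
- exact: Wl.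
Qed.

Lemma SW_graph w : W w -> SW W (w, - D (D w)).
Proof.
move=> Ww; apply/SWP; split; first exact/Smax_intro/admissible_H2.
by exists 0, w; split=> //; [exact: Smin_dom0|rewrite add0r].
Qed.

Lemma SW_dom u : dom (SW W) u <-> exists f w, [/\ dom (Smin R) f, W w & u = f + w].
Proof.
split=> [[y /SWP[_]] //|[f [w [Sf Ww E]]]].
exists (- D (D u)); apply/SWP; split; last by exists f, w.
apply: Smax_intro; rewrite E -[f]scale1r; apply: H2_lin; last exact: admissible_H2.
by have /Smin_domP[] := Sf.
Qed.

Lemma SW_dissipative : (forall w, W w -> qn w <= pn w) -> dissipative (SW W).
Proof.
move=> h; apply/(dissipativeP SW_sub Smin_sub_SW SW_submod) => u.
move=> /SW_dom[f [w [Sf Ww ->]]]; have [a b c d] := dom_Smin_pq (admissible_H2 Ww) Sf.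
by rewrite /qn /pn a b c d; exact: h.
Qed.

(** On W, p = 0 forces q = 0 and then w = 0, as W meets D(S) only in 0; so p is injective on a
    two-dimensional space. *)
Lemma p_onto : (forall w, W w -> qn w <= pn w) ->
  forall a b, exists2 w, W w & p0 w = a /\ p1 w = b.
Proof.
move=> h; have [_ _ _ B] := aW.
apply: (H2_surj admissible_H2 B); [exact: p0_lin|exact: p1_lin|].
move=> w Ww w0 w1; have [] := @qn_le0 w; last exact: admissible_eq0.
by rewrite -(pn0 w0 w1); exact: h.
Qed.

Lemma q_onto : (forall w, W w -> pn w <= qn w) ->
  forall a b, exists2 w, W w & q0 w = a /\ q1 w = b.
Proof.
move=> h; have [_ _ _ B] := aW.
apply: (H2_surj admissible_H2 B); [exact: q0_lin|exact: q1_lin|].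
move=> w Ww w0 w1; have [] := @pn_le0 w; last by move=> *; exact: admissible_eq0.
by rewrite -(qn0 w0 w1); exact: h.
Qed.

Lemma SW_maximally_dissipative : (forall w, W w -> qn w <= pn w) ->
  maximally_dissipative (SW W).
Proof.
move=> h; split; first exact: SW_dissipative.
move=> T dT ST; apply/seteqP; split=> // s Ts.
have STmin : Smin R `<=` T by apply: subset_trans ST; exact: Smin_sub_SW.
have TS := dissipative_sub_Smax dT STmin.
have [[Tl _] _ _] := dT; have Td := (dissipativeP TS STmin Tl).1 dT.
have [sH sE] := SmaxE (TS _ Ts).
(* w has the same p-data as s.1. The difference is in the domain of the dissipative T and has p = 0,
   hence q = 0, so it lies in D(S). *)
have [w Ww [w0 w1]] := p_onto h (p0 s.1) (p1 s.1).
have wH := admissible_H2 Ww.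
have Tw := ST _ (SW_graph Ww).
apply/SWP; split; first exact: TS.
have [Tz Tlin] := (submod_closedP _).1 Tl.
have dTsw : dom T (s.1 - w).
  exists (-1 *: (- D (D w)) + s.2).
  have -> : s.1 - w = -1 *: w + s.1 by rewrite scaleN1r addrC.
  exact: (Tlin (-1) _ _ Tw Ts).
have swp (F : L2 R -> R[i]) : H2_linear F -> F w = F s.1 -> F (s.1 - w) = 0.
  move=> L e; have := L (-1) _ _ wH sH.
  by rewrite scaleN1r e mulN1r addNr addrC.
have e0 := swp _ (@p0_lin R) w0; have e1 := swp _ (@p1_lin R) w1.
have pz := pn0 e0 e1; have qz : qn (s.1 - w) <= 0.
  by apply: le_trans (Td _ dTsw) _; rewrite le_eqVlt; apply/orP; left; apply/eqP; exact: pz.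
have [z0 z1] := qn_le0 qz.
have zH : H2 R (s.1 - w) by rewrite addrC -scaleN1r; exact: H2_lin.
exists (s.1 - w), w; apply: And3 Ww (esym (subrK w s.1)).
exact: (Smin_domP _).2 (And5 zH e0 e1 z0 z1).
Qed.

Lemma SW_selfadjoint :
  selfadjoint (SW W) <-> forall w w', W w -> W w' -> bform w w' = 0.
Proof.
split=> [[_ _ adjE] w w' Ww Ww'|h].
  apply/(green_bform0 (admissible_H2 Ww) (admissible_H2 Ww')).
  have : adjoint (SW W) (w, - D (D w)) by rewrite adjE; exact: SW_graph.
  by move=> /(_ _ _ (SW_graph Ww')).
have hq w (Ww : W w) := bform0_qn_le h Ww.
have ple w : W w -> qn w <= pn w by move=> /hq ->.
have qle w : W w -> pn w <= qn w by move=> /hq ->.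
have [lin dd _] := SW_dissipative ple.
split=> //; apply/seteqP; split=> [s adj|s SWs x y SWxy].
  have sS : Smax R s.
    by rewrite -adjoint_Smin => x y Sxy; apply: adj; exact: Smin_sub_SW.
  have [sH sE] := SmaxE sS.
  apply/SWP; split=> //.
  have [w Ww [w0 w1]] := p_onto ple (p0 s.1) (p1 s.1).
  have wH := admissible_H2 Ww.
  have bs z : W z -> bform s.1 z = 0.
    move=> Wz; apply/(green_bform0 sH (admissible_H2 Wz)).
    by have := adj _ _ (SW_graph Wz); rewrite {2}sE.
  (* Both s.1 and w are [bform]-orthogonal to W and have equal p-data, so only the q-terms survive
     in the difference. *)
  have d z : W z -> ((q0 s.1 - q0 w)^*)%R * q0 z + ((q1 s.1 - q1 w)^*)%R * q1 z = 0.
    move=> Wz; apply: conj_diff_eq0 (bs z Wz) _.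
    apply: etrans (congr2 (fun a b => (a^*)%R * p0 z + (b^*)%R * p1 z -
      ((q0 w)^*)%R * q0 z - ((q1 w)^*)%R * q1 z) (esym w0) (esym w1)) _.
    exact: h w z Ww Wz.
  (* Testing with the z whose q-data are this very difference shows that the difference vanishes. *)
  have [z Wz [z0 z1]] := q_onto qle (q0 s.1 - q0 w) (q1 s.1 - q1 w).
  have := d z Wz; rewrite z0 z1 !conj_mul => /(congr1 Re) /= e.
  have n0 := nsq_ge0 (q0 s.1 - q0 w); have n1 := nsq_ge0 (q1 s.1 - q1 w).
  have /eqP e0 : q0 s.1 - q0 w = 0.
    by apply: nsq_eq0; move: n0 n1 e; move: (nsq _) (nsq _) => *; lra.
  have /eqP e1 : q1 s.1 - q1 w = 0.
    by apply: nsq_eq0; move: n0 n1 e; move: (nsq _) (nsq _) => *; lra.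
  move: e0 e1; rewrite !subr_eq0 => /eqP e0 /eqP e1.
  exists (s.1 - w), w; apply: And3 Ww (esym (subrK w s.1)).
  exact: (pq_sub_Smin sH wH (esym w0) (esym w1) e0 e1).
(* For the symmetry of S_W, summands from D(S) do not change p and q, so [bform] is evaluated on W
   alone. *)
have [sH sE] := SmaxE (SW_sub SWs); have [xH xE] := SmaxE (SW_sub SWxy).
have dx : dom (SW W) x by exists y.
have ds : dom (SW W) s.1 by exists s.2; case: s SWs {sH sE}.
move: xE => [->]; rewrite {2}sE; apply/(green_bform0 sH xH).
move: dx => /SW_dom[f [w [Sf Ww ->]]]; move: ds => /SW_dom[g [z [Sg Wz ->]]].
have [a b c d] := dom_Smin_pq (admissible_H2 Ww) Sf.
have [a' b' c' d'] := dom_Smin_pq (admissible_H2 Wz) Sg.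
by rewrite /bform a b c d a' b' c' d'; exact: h Wz Ww.
Qed.

End Admissible.
End Extensions.

(** * Every maximally dissipative extension of S is some S_W *)

Section Maximality.
Variable R : realType.
Local Notation Re := (@complex.Re R).
Local Notation Im := (@complex.Im R).
Implicit Types (f g h u v w : L2 R) (a b c d : R[i]) (W : set (L2 R)) (T : set (L2 R * L2 R)).

(** Pythagoras: adding a vector orthogonal to (a, b) does not shorten it. *)
Lemma nsq_orth (c e0 e1 a b : R[i]) : (e0^*)%R * a + (e1^*)%R * b = 0 ->
  nsq a + nsq b <= nsq (c * e0 + a) + nsq (c * e1 + b).
Proof.
move=> o; have -> : nsq (c * e0 + a) + nsq (c * e1 + b) =
   nsq c * (nsq e0 + nsq e1) + (nsq a + nsq b) +
   2 * Re ((c^*)%R * ((e0^*)%R * a + (e1^*)%R * b)).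
  by rewrite /nsq !reimE; ring.
rewrite o mulr0 /= mulr0 addr0 lerDr.
by apply: mulr_ge0; [|apply: addr_ge0]; exact: nsq_ge0.
Qed.

Section MaximalOperator.
Variable T : set (L2 R * L2 R).
Hypotheses (ST : Smin R `<=` T) (mT : maximally_dissipative T).

Let dT : dissipative T := mT.1.
Let TS : T `<=` Smax R := dissipative_sub_Smax dT ST.
Let Tsub : submod_closed (mem T).
Proof. by have [[]] := dT. Qed.
Let Tlin : forall c (s t : L2 R * L2 R), T s -> T t -> T (c *: s + t).
Proof. by have [] := (submod_closedP T).1 Tsub. Qed.
Let Tle u : dom T u -> qn u <= pn u.
Proof. exact: (dissipativeP TS ST Tsub).1. Qed.

Let dom_graph u : dom T u -> T (u, - D (D u)).
Proof.
by move=> [y Ty]; have [_ e] := SmaxE (TS Ty); exact: (eq_ind _ T Ty _ e).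
Qed.

Let dom_H2 u : dom T u -> H2 R u.
Proof. by move=> /dom_graph /TS /SmaxE[]. Qed.

Let dom_lin c u v : dom T u -> dom T v -> dom T (c *: u + v).
Proof.
move=> /dom_graph Tu /dom_graph Tv.
by exists (c *: (- D (D u)) + (- D (D v))); exact: (Tlin c Tu Tv).
Qed.

(* Otherwise T could be extended by a function z with p-data orthogonal to
   those of T and with vanishing q-data. *)
Lemma maximal_p_onto a b : exists u, [/\ dom T u, p0 u = a & p1 u = b].
Proof.
pose P a b := exists u, [/\ dom T u, p0 u = a & p1 u = b].
apply: contrapT => nP.
have dom0 : dom T 0.
  by exists 0; have [] := (submod_closedP T).1 Tsub.
have [||| e0 [e1 [epos eo]]] := @C2_orth R P.
- by exists 0; split=> //; apply: H2_linear0; [exact: p0_lin|exact: p1_lin].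
- move=> c x y x' y' [u [du <- <-]] [v [dv <- <-]]; exists (c *: u + v).
  have [uH vH] := (dom_H2 du, dom_H2 dv).
  by split; [exact: dom_lin|exact: p0_lin|exact: p1_lin].
- by exists a, b.
have [z [zH z0 z1 y0 y1]] := H2_pq e0 e1.
pose T' := [set s | exists c t, T t /\ s = c *: (z, - D (D z)) + t].
have TT' : T `<=` T'.
  by move=> t Tt; exists 0, t; split=> //; rewrite scale0r add0r.
have T'S : T' `<=` Smax R.
  move=> s [c [t [Tt ->]]]; apply: (Smax_submod R).2; last exact: TS.
  exact: Smax_intro.
have T'sub : submod_closed (mem T').
  apply/submod_closedP; split.
    by apply: TT'; have [] := (submod_closedP T).1 Tsub.
  move=> c s t [x [s' [Ts ->]]] [y [t' [Tt ->]]].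
  exists (c * x + y), (c *: s' + t'); split; first exact: Tlin.
  by rewrite scalerDr scalerA scalerDl addrACA.
have dT' : dissipative T'.
  apply/(dissipativeP T'S (subset_trans ST TT') T'sub) => u [y [c [t [Tt E]]]].
  have dt : dom T t.1 by exists t.2; case: t Tt {E}.
  have tH := dom_H2 dt.
  have uE : u = c *: z + t.1 := congr1 fst E.
  have qE : qn u = qn t.1.
    have F (F : L2 R -> R[i]) : H2_linear F -> F z = 0 -> F u = F t.1.
      by move=> L Fz; rewrite uE; have := L c _ _ zH tH; rewrite Fz mulr0 add0r.
    by rewrite /qn (F _ (@q0_lin R) y0) (F _ (@q1_lin R) y1).
  rewrite qE; apply: le_trans (Tle dt) _.
  have F (F : L2 R -> R[i]) e : H2_linear F -> F z = e -> F u = c * e + F t.1.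
    by move=> L Fz; rewrite uE; have := L c _ _ zH tH; rewrite Fz.
  rewrite /pn (F _ _ (@p0_lin R) z0) (F _ _ (@p1_lin R) z1).
  exact: (nsq_orth c (eo _ _ (ex_intro _ t.1 (And3 dt erefl erefl)))).
have T'T : T' = T := mT.2 T' dT' TT'.
have dz : dom T z.
  exists (- D (D z)); rewrite -T'T; exists 1, 0.
  by rewrite scale1r addr0; split=> //; have [] := (submod_closedP T).1 Tsub.
(* With z in the domain of T, the nonzero vector (e0, e1) would be orthogonal to itself. *)
have := eo e0 e1 (ex_intro _ z (And3 dz z0 z1)).
by rewrite !conj_mul => /(congr1 Re) /= e; move: epos; rewrite e ltxx.
Qed.

(** W is spanned by elements of the domain whose p-data are the unit vectors, so the coefficients of
    w are [p0 w] and [p1 w]; this gives independence, even modulo D(S). The inclusion of S_W in T is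
    direct, and equality follows from the maximality of S_W. *)
Lemma maximal_eq_SW : exists W, [/\ admissible W,
  exists u v, basis2 W u v /\ psdmx (boundary_mx u v) & T = SW W].
Proof.
have [u [du u0 u1]] := maximal_p_onto 1 0.
have [v [dv v0 v1]] := maximal_p_onto 0 1.
have [uH vH] := (dom_H2 du, dom_H2 dv).
pose W := [set w | exists a b, w = a *: u + b *: v].
have dom0 : dom T 0 by exists 0; have [] := (submod_closedP T).1 Tsub.
have WT w : W w -> dom T w.
  move=> [a [b ->]]; apply: dom_lin => //.
  by rewrite -[b *: v]addr0; exact: dom_lin.
have WH : W `<=` H2 R by move=> w /WT; exact: dom_H2.
have W0 a b : p0 (a *: u + b *: v) = a.
  apply: etrans (H2_linear_comb uH vH (@p0_lin R) a b) _.
  by rewrite u0 v0 mulr1 mulr0 addr0.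
have W1 a b : p1 (a *: u + b *: v) = b.
  apply: etrans (H2_linear_comb uH vH (@p1_lin R) a b) _.
  by rewrite u1 v1 mulr1 mulr0 add0r.
have S0 := Smin_dom0 R.
have free a b : dom (Smin R) (a *: u + b *: v) -> a = 0 /\ b = 0.
  by move=> /Smin_domP[_ h0 h1 _ _]; split; [rewrite -h0 W0|rewrite -h1 W1].
have B : basis2 W u v.
  by split=> // a b e; apply: free; rewrite e.
have aW : admissible W.
  split; last by exists u, v.
  - apply/submod_closedP; split.
      by exists 0, 0; rewrite !scale0r addr0.
    move=> c w x [a [b ->]] [a' [b' ->]]; exists (c * a + a'), (c * b + b').
    by rewrite scalerDr !scalerA !scalerDl addrACA.
  - move=> w Ww; exists (- D (D w)); rewrite adjoint_Smin.
    exact/Smax_intro/WH.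
  - apply/seteqP; split=> [w [[a [b ->]] /free[-> ->]]|w ->].
      by rewrite /= !scale0r addr0.
    by split=> //; exists 0, 0; rewrite !scale0r addr0.
have Wle w : W w -> qn w <= pn w by move=> /WT; exact: Tle.
exists W; split=> //; first by exists u, v; split=> //; exact/(psdmxP WH B).
have [_ mSW] := SW_maximally_dissipative aW Wle.
apply: mSW => // s /SWP[Ss [f [w [[y Sf] Ww sE]]]].
have [_ sE'] := SmaxE Ss.
have ds : dom T s.1.
  rewrite sE -[f]scale1r; apply: dom_lin; last exact: WT.
  by exists y; exact: ST.
by rewrite sE'; exact: dom_graph.
Qed.

End MaximalOperator.
End Maximality.
Theorem theorem3p2 (R : realType) :
  [/\ adjoint (Smin R) = Smax R,
      forall T : set (L2 R * L2 R),
        (Smin R `<=` T /\ maximally_dissipative T) <->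
        (exists W : set (L2 R),
           [/\ admissible W,
               exists u v, basis2 W u v /\ psdmx (boundary_mx u v) &
               T = SW W]),
      forall W : set (L2 R), admissible W ->
        (exists u v, basis2 W u v /\ psdmx (boundary_mx u v)) <->
        (forall u v, basis2 W u v -> psdmx (boundary_mx u v)),
      forall W : set (L2 R), admissible W ->
        selfadjoint (SW W) <->
        (exists u v, basis2 W u v /\ boundary_mx u v = 0) &
      forall W : set (L2 R), admissible W ->
        (exists u v, basis2 W u v /\ boundary_mx u v = 0) <->
        (forall u v, basis2 W u v -> boundary_mx u v = 0)].
Proof.
split.
- exact: adjoint_Smin.
- move=> T; split=> [[ST mT]|[W [aW [u [v [B P]]] ->]]]; first exact: maximal_eq_SW.
  split; first exact: Smin_sub_SW.
  apply: SW_maximally_dissipative => //.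
  exact/(psdmxP (admissible_H2 aW) B).
(* The basis that [admissible] provides is the witness when passing from every basis to some
   basis. *)
- move=> W aW; have [_ _ _ [u0 [v0 B0]]] := aW; have WH := admissible_H2 aW.
  split=> [[u [v [B /(psdmxP WH B) h]]] u' v' B'|h]; first exact/(psdmxP WH B').
  by exists u0, v0; split=> //; exact: h.
- move=> W aW; have [_ _ _ [u0 [v0 B0]]] := aW; have WH := admissible_H2 aW.
  split=> [/(SW_selfadjoint aW) h|[u [v [B /(boundary_mx_eq0P WH B) h]]]].
    by exists u0, v0; split=> //; exact/(boundary_mx_eq0P WH B0).
  exact/(SW_selfadjoint aW).
- move=> W aW; have [_ _ _ [u0 [v0 B0]]] := aW; have WH := admissible_H2 aW.
  split=> [[u [v [B /(boundary_mx_eq0P WH B) h]]] u' v' B'|h].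
    exact/(boundary_mx_eq0P WH B').
  by exists u0, v0; split=> //; exact: h.
Qed.
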